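(* Let $\Sigma\subset\mathbb{C}$ be a simply connected domain and let $X:\Sigma\to\mathbb{I}^3$ be a conformal immersion with mean curvature $H$. Let $B:\Sigma\to\mathcal{G}=\mathbb{R}^+\otimes\mathrm{SU}(1,0,1)$ be smooth. Then a spin transformation $\tilde X:\Sigma\to\mathbb{I}^3$ of $X$ by $B$, i.e. a map with $\mathrm{d}\tilde X=B\,\mathrm{d}X\,B^*$, is well-defined (equivalently, the matrix-valued $1$-form $B\,\mathrm{d}X\,B^*$ is closed) if and only if there is a function $\rho:\Sigma\to\mathbb{R}$ such that $$B^{-1}\mathrm{d}B\wedge \mathrm{d}X=-\rho\,\mathrm{d}X\wedge\tilde{\mathfrak{P}}\,\mathrm{d}X,\qquad \tilde{\mathfrak{P}}=\begin{pmatrix}0&0\\0&-1\end{pmatrix}.$$ Furthermore, in this case the mean curvature $\tilde H$ of $\tilde X$ is $$\tilde H=\frac{H+\rho}{\det B}.$$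
   Context: All maps are smooth. $\mathbb{L}^4$ is $\mathbb{R}^4$ with $\langle x,y\rangle=-x_0y_0+x_1y_1+x_2y_2+x_3y_3$. It is identified with the $2\times 2$ Hermitian matrices $\mathrm{Herm}(2)$ by $x=(x_0,x_1,x_2,x_3)^t\sim X=\begin{pmatrix}x_0+x_3&x_1+ix_2\\ x_1-ix_2&x_0-x_3\end{pmatrix}$, so that $\langle x,x\rangle=-\det X$. With $\mathfrak{p}=(1,0,0,1)^t$, isotropic $3$-space is $\mathbb{I}^3=\{x\in\mathbb{L}^4:\langle x,\mathfrak{p}\rangle=0\}$ with the induced degenerate metric; in the matrix model $\mathbb{I}^3=\left\{\begin{pmatrix}2x_0&x_1+ix_2\\ x_1-ix_2&0\end{pmatrix}:x_0,x_1,x_2\in\mathbb{R}\right\}$. $\mathrm{SU}(1,0,1)=\left\{\begin{pmatrix}e^{i\theta}&w\\0&e^{-i\theta}\end{pmatrix}:\theta\in\mathbb{R},\,w\in\mathbb{C}\right\}$, and $\mathcal{G}=\mathbb{R}^+\otimes\mathrm{SU}(1,0,1)=\{rA: r>0,\ A\in\mathrm{SU}(1,0,1)\}$. $B^*$ denotes the conjugate transpose. A conformal immersion $x:\Sigma\to\mathbb{I}^3$ (matrix form $X$), with complex coordinate $z=u+iv$ on $\Sigma$, is an immersion whose induced metric is Riemannian and equals $\mathrm{d}s^2=e^{2\sigma}(\mathrm{d}u^2+\mathrm{d}v^2)=e^{2\sigma}\mathrm{d}z\,\mathrm{d}\bar z$ for some $\sigma:\Sigma\to\mathbb{R}$. Its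 lightlike Gauss map is the unique map $g:\Sigma\to\mathcal{L}=\{y\in\mathbb{L}^4:\langle y,y\rangle=0\}$ with $\langle g,\mathfrak{p}\rangle=1$ and $\langle \mathrm{d}x,g\rangle=0$. Its mean curvature is $H=2e^{-2\sigma}\langle x_{z\bar z},g\rangle$, where $\partial_z=\tfrac12(\partial_u-i\partial_v)$, $\partial_{\bar z}=\tfrac12(\partial_u+i\partial_v)$. A conformal immersion $\tilde X:\Sigma\to\mathbb{I}^3$ is a spin transformation of $X$ if $\mathrm{d}\tilde X=B\,\mathrm{d}X\,B^*$ for some $B:\Sigma\to\mathcal{G}$. Wedge products of matrix-valued $1$-forms use matrix multiplication of the coefficients. *)

(* Defs.v *)
From HB Require Import structures.
From mathcomp Require Import all_boot all_order all_algebra.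
From mathcomp Require Import all_classical all_reals all_analysis.
From mathcomp Require Import complex.

Set Implicit Arguments.
Unset Strict Implicit.
Unset Printing Implicit Defensive.

Import Order.TTheory GRing.Theory Num.Theory.
Import numFieldNormedType.Exports.

Local Open Scope classical_set_scope.
Local Open Scope ring_scope.
Local Open Scope complex_scope.

(* The complex plane, z = u + iv being written (u, v). It is not taken to be
   R[i], which is not a normed module over R. *)
Notation plane R := (R * R)%type.

Section Plane.
Context {R : realType}.
Implicit Types (Sigma : set (plane R)).

Definition simply_connected_domain Sigma : Prop :=
  [/\ open Sigma, Sigma !=set0, connected Sigma &
      forall gamma : R -> plane R,
        {within `[0, 1], continuous gamma} -> gamma @` `[0, 1] `<=` Sigma ->
        gamma 0 = gamma 1 ->
        exists h : R * R -> plane R,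
          [/\ {within `[0, 1] `*` `[0, 1], continuous h},
              h @` (`[0, 1] `*` `[0, 1]) `<=` Sigma,
              forall t, t \in `[0, 1] -> h (0, t) = gamma t /\ h (1, t) = gamma 0 &
              forall s, s \in `[0, 1] -> h (s, 0) = gamma 0 /\ h (s, 1) = gamma 0]].

Definition e_u : plane R := (1, 0).
Definition e_v : plane R := (0, 1).

Fixpoint continuously_differentiable (W : normedModType R) (n : nat) Sigma
    (f : plane R -> W) : Prop :=
  (forall p, Sigma p -> {for p, continuous f}) /\
  if n is n'.+1 then
    [/\ forall p, Sigma p -> derivable f p e_u /\ derivable f p e_v,
        continuously_differentiable n' Sigma ('D_e_u f) &
        continuously_differentiable n' Sigma ('D_e_v f)]
  else True.

Definition smooth (W : normedModType R) Sigma (f : plane R -> W) : Prop :=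
  forall n, continuously_differentiable n Sigma f.

End Plane.

Section ComplexMatrixCalculus.
Context {R : realType} {m n : nat}.
Implicit Types (Sigma : set (plane R)) (F : plane R -> 'M[R[i]]_(m, n)).

Definition smooth_mx Sigma F : Prop :=
  forall i j, smooth Sigma (fun p => complex.Re (F p i j)) /\
              smooth Sigma (fun p => complex.Im (F p i j)).

Definition partial (w : plane R) F : plane R -> 'M[R[i]]_(m, n) :=
  fun p => \matrix_(i, j) ('D_w (fun q => complex.Re (F q i j)) p
                           +i* 'D_w (fun q => complex.Im (F q i j)) p).

Definition partial_z F : plane R -> 'M[R[i]]_(m, n) :=
  fun p => 2^-1 *: (partial e_u F p - (0 +i* 1) *: partial e_v F p).

Definition partial_zbar F : plane R -> 'M[R[i]]_(m, n) :=
  fun p => 2^-1 *: (partial e_u F p + (0 +i* 1) *: partial e_v F p).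

End ComplexMatrixCalculus.

Section MatrixForms.
Context {R : realType}.
Implicit Types (Sigma : set (plane R)) (F A B : plane R -> 'M[R[i]]_2).

(* A 1-form P du + Q dv is given by p |-> (P p, Q p), and a 2-form by the
   coefficient of du /\ dv. *)
Definition form1 := plane R -> 'M[R[i]]_2 * 'M[R[i]]_2.
Definition form2 := plane R -> 'M[R[i]]_2.

Definition d0 F : form1 := fun p => (partial e_u F p, partial e_v F p).

Definition d1 (alpha : form1) : form2 := fun p =>
  partial e_u (fun q => (alpha q).2) p - partial e_v (fun q => (alpha q).1) p.

Definition closed_form Sigma (alpha : form1) : Prop := forall p, Sigma p -> d1 alpha p = 0.

Definition mulf_form A (alpha : form1) : form1 :=
  fun p => (A p *m (alpha p).1, A p *m (alpha p).2).

Definition form_mulf (alpha : form1) A : form1 :=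
  fun p => ((alpha p).1 *m A p, (alpha p).2 *m A p).

Definition wedge (alpha beta : form1) : form2 := fun p =>
  (alpha p).1 *m (beta p).2 - (alpha p).2 *m (beta p).1.

Definition adjoint (M : 'M[R[i]]_2) : 'M[R[i]]_2 := map_mx conjc M^T.

End MatrixForms.

Section IsotropicSpace.
Context {R : realType}.
Implicit Types (Sigma : set (plane R)).

Definition mx2 (T : Type) (a b c d : T) : 'M[T]_2 :=
  \matrix_(i, j) if i == 0 then (if j == 0 then a else b)
                           else (if j == 0 then c else d).

Definition lorentz (K : pzRingType) (x y : 'cV[K]_4) : K :=
  - (x 0 0 * y 0 0) + x 1 0 * y 1 0 + x 2 0 * y 2 0 + x 3 0 * y 3 0.

Definition herm (x : 'cV[R]_4) : 'M[R[i]]_2 :=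
  mx2 ((x 0 0 + x 3 0)%:C) (x 1 0 +i* x 2 0)
      (x 1 0 -i* x 2 0)    ((x 0 0 - x 3 0)%:C).

Definition vec_p : 'cV[R]_4 := \col_i (if (i == 0) || (i == 3) then 1 else 0).

Definition isotropic3 : set 'cV[R]_4 := [set x | lorentz x vec_p = 0].

Definition SU101 : set 'M[R[i]]_2 :=
  [set A | exists (theta : R) (w : R[i]),
     A = mx2 (cos theta +i* sin theta) w
             0                         (cos (- theta) +i* sin (- theta))].

Definition groupG : set 'M[R[i]]_2 :=
  [set M | exists (r : R) (A : 'M[R[i]]_2), [/\ 0 < r, SU101 A & M = r%:C *: A]].

Definition mx_Ptilde : 'M[R[i]]_2 := mx2 0 0 0 (-1).

Implicit Types (x : plane R -> 'cV[R]_4).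

(* The induced metric is e^(2s) (du^2 + dv^2) at p. *)
Definition conformal_at x (p : plane R) (s : R) : Prop :=
  [/\ lorentz ('D_e_u x p) ('D_e_u x p) = expR (2 * s),
      lorentz ('D_e_v x p) ('D_e_v x p) = expR (2 * s) &
      lorentz ('D_e_u x p) ('D_e_v x p) = 0].

Definition immersion_at x (p : plane R) : Prop :=
  forall a b : R, a *: 'D_e_u x p + b *: 'D_e_v x p = 0 -> a = 0 /\ b = 0.

Definition conformal_immersion Sigma x : Prop :=
  [/\ smooth Sigma x, forall p, Sigma p -> isotropic3 (x p),
      forall p, Sigma p -> immersion_at x p &
      exists2 sigma : plane R -> R,
        smooth Sigma sigma & forall p, Sigma p -> conformal_at x p (sigma p)].

Definition log_factor x (p : plane R) : R := get (conformal_at x p).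

Definition lightlike_normal x (p : plane R) : set 'cV[R]_4 :=
  [set y | [/\ lorentz y y = 0, lorentz y vec_p = 1,
               lorentz ('D_e_u x p) y = 0 & lorentz ('D_e_v x p) y = 0]].

Definition gauss_map x (p : plane R) : 'cV[R]_4 := get (lightlike_normal x p).

Definition complexify (y : 'cV[R]_4) : 'cV[R[i]]_4 := map_mx (real_complex R) y.

(* The product is extended to C^4 bilinearly. The value is a real number by the
   symmetry of second derivatives, but is kept in R[i]. *)
Definition mean_curvature x (p : plane R) : R[i] :=
  2 * (expR (- 2 * log_factor x p))%:C *
  lorentz (partial_zbar (partial_z (fun q => complexify (x q))) p)
          (complexify (gauss_map x p)).

Definition spin_form (B : plane R -> 'M[R[i]]_2) (x : plane R -> 'cV[R]_4) : form1 :=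
  form_mulf (mulf_form B (d0 (fun p => herm (x p)))) (fun p => adjoint (B p)).

(* Such an x' is automatically a conformal immersion; this is not assumed. *)
Definition spin_transformation Sigma (B : plane R -> 'M[R[i]]_2)
    (x x' : plane R -> 'cV[R]_4) : Prop :=
  [/\ smooth Sigma x', forall p, Sigma p -> isotropic3 (x' p) &
      forall p, Sigma p -> d0 (fun q => herm (x' q)) p = spin_form B x p].

Definition spin_potential Sigma (B : plane R -> 'M[R[i]]_2)
    (x : plane R -> 'cV[R]_4) (rho : plane R -> R) : Prop :=
  let dX := d0 (fun p => herm (x p)) in
  smooth Sigma rho /\
  forall p, Sigma p ->
    wedge (mulf_form (fun q => invmx (B q)) (d0 B)) dX p =
    - ((rho p)%:C *: wedge dX (mulf_form (fun=> mx_Ptilde) dX) p).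

End IsotropicSpace.

(* Main.v *)
Require Import Defs.
From mathcomp Require Import all_boot all_order all_algebra.
From mathcomp Require Import all_classical all_reals all_analysis.
From mathcomp Require Import complex.
From mathcomp Require Import ring lra.

Set Implicit Arguments.
Unset Strict Implicit.
Unset Printing Implicit Defensive.

Import Order.TTheory GRing.Theory Num.Theory.
Import numFieldNormedType.Exports.

Local Open Scope classical_set_scope.
Local Open Scope ring_scope.
Local Open Scope complex_scope.

(** Write the entries of B as a (upper left), b (upper right) and the conjugate
    of a, and a point of isotropic space as h = x_0 together with the complex
    number zeta = x_1 + i x_2. The induced metric is |dzeta|^2, so that dX has
    entries 2 dh, dzeta and the conjugate of dzeta. Multiplying out, B dX B^* is
    again of this shape: it replaces dzeta by a^2 dzeta and dh by
      |a|^2 dh + Re (b conj(a) conj(dzeta)).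
    Hence finding X' amounts to finding primitives of three real 1-forms, and on
    a simply connected domain these exist exactly when the forms are closed.

    Closedness reads as two conditions on dB /\ dX. The form a^2 dzeta is closed
    iff da /\ dzeta = 0, which is the upper right entry of dB /\ dX; granting
    this, the other form is closed iff Re (conj(a) q) = 0, where
    q = 2 da /\ dh + db /\ conj(dzeta) is the upper left entry. On the other side
    the matrix dX /\ Ptilde dX has the single nonzero entry 2 i J, J being the
    Jacobian of zeta. So the equation of the theorem says da /\ dzeta = 0 and
    q = - 2 i rho a J; since J does not vanish, a real rho with this property
    exists iff conj(a) q is purely imaginary, the same condition. This is
    curl_spin, spin_closedE and spin_potentialE.

    For the curvature, differentiating the conformality relations shows that zeta
    is harmonic, whatever the orientation (conformal_harmonic). The Gauss map
    therefore only sees the Laplacian of h, and H = e^(-2 sigma) Delta h / 2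
    (mean_curvatureE). The metric of X' is |a|^4 times that of X. Differentiating
    the formula for dh' and using that zeta and a are both holomorphic or both
    antiholomorphic gives Delta h' = |a|^2 (Delta h + 2 rho e^(2 sigma))
    (spin_laplacian_alg), which is the formula for the curvature.

    The Poincare lemma is proved by monodromy. On a square a closed form has a
    primitive by integration along the axes and differentiation under the
    integral sign (local_primitive). The increments of local primitives can be
    followed along a continuous path; a lift along one loop of a homotopy can be
    moved to the neighbouring loops (lifts_deform), so that the total increment
    along a null-homotopic loop vanishes (joined_loop), and the increment along a
    path from a base point defines a global primitive
    (exact_of_locally_exact). *)

(** * Derivatives along the axes *)

Section Lines.
Context {R : realType}.
Implicit Types (f : plane R -> R) (p q : plane R).

Lemma ballP p q (r : R) : ball p r q <-> `|p.1 - q.1| < r /\ `|p.2 - q.2| < r.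
Proof. by []. Qed.

Lemma derivable_e_u f u v : derivable f (u, v) e_u <-> derivable (fun s => f (s, v)) u 1.
Proof.
rewrite /derivable.
set g1 := fun h => _; set g2 := fun h => _; suff -> : g1 = g2 by [].
apply/funext => h; rewrite /g1 /g2 /e_u /=; congr (_ *: (f _ - _)).
by rewrite /GRing.add /GRing.scale /= /add_pair /= !scaler0 add0r.
Qed.

Lemma derivable_e_v f u v : derivable f (u, v) e_v <-> derivable (fun s => f (u, s)) v 1.
Proof.
rewrite /derivable.
set g1 := fun h => _; set g2 := fun h => _; suff -> : g1 = g2 by [].
apply/funext => h; rewrite /g1 /g2 /e_v /=; congr (_ *: (f _ - _)).
by rewrite /GRing.add /GRing.scale /= /add_pair /= !scaler0 add0r.
Qed.

Lemma derive_e_u f u v : 'D_e_u f (u, v) = 'D_1 (fun s => f (s, v)) u.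
Proof.
rewrite /derive.
set g1 := fun h => _; set g2 := fun h => _; suff -> : g1 = g2 by [].
apply/funext => h; rewrite /g1 /g2 /e_u /=; congr (_ *: (f _ - _)).
by rewrite /GRing.add /GRing.scale /= /add_pair /= !scaler0 add0r.
Qed.

Lemma derive_e_v f u v : 'D_e_v f (u, v) = 'D_1 (fun s => f (u, s)) v.
Proof.
rewrite /derive.
set g1 := fun h => _; set g2 := fun h => _; suff -> : g1 = g2 by [].
apply/funext => h; rewrite /g1 /g2 /e_v /=; congr (_ *: (f _ - _)).
by rewrite /GRing.add /GRing.scale /= /add_pair /= !scaler0 add0r.
Qed.

Lemma is_derive1_line f (p w : plane R) (l : R) :
  is_derive p w f l <-> is_derive (0 : R) (1 : R) (fun h : R => f (h *: w + p)) l.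
Proof.
have E : 'D_1 (fun h : R => f (h *: w + p)) 0 = 'D_w f p.
  rewrite /derive; set g1 := fun h => _; set g2 := fun h => _; suff -> : g1 = g2 by [].
  by apply/funext => h; rewrite /g1 /g2 /= addr0 scale0r add0r [_%:A]mulr1.
split=> -[d e].
- by apply: DeriveDef; [move/derivable1P : d|rewrite E].
- by apply: DeriveDef; [exact/derivable1P|rewrite -E].
Qed.

End Lines.

(* From here on partial derivatives are handled through lemmas only, never by
   unfolding the limits that define them. *)
#[local] Opaque e_u e_v derive.

Section Axes.
Context {R : realType}.
Implicit Types (f : plane R -> R) (p q : plane R).

Definition between (a b s : R) := Num.min a b <= s <= Num.max a b.

(** Balls of the plane are squares, and this is their convexity along an axis. *)
Lemma between_dist (c r a b s : R) :
  `|c - a| < r -> `|c - b| < r -> between a b s -> `|c - s| < r.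
Proof.
rewrite /between ge_min le_max !ltr_norml => /andP[? ?] /andP[? ?].
by move=> /andP[/orP[?|?] /orP[?|?]]; apply/andP; split; lra.
Qed.

Lemma between_dist_le (a b s : R) : between a b s -> `|a - s| <= `|a - b|.
Proof.
rewrite /between; case: (leP a b) => ab /andP[h1 h2].
  by rewrite distrC [leRHS]distrC !ger0_norm ?subr_ge0 //; lra.
by rewrite !ger0_norm ?subr_ge0 //; lra.
Qed.

Lemma mean_value (g : R -> R) (a b : R) :
  (forall s, between a b s -> derivable g s 1) ->
  exists2 c, between a b c & g b - g a = 'D_1 g c * (b - a).
Proof.
move=> dg; wlog ab : a b dg / a <= b.
  move=> W; case: (leP a b) => [|/ltW] ab; first exact: W.
  have [c cab e] : exists2 c, between b a c & g a - g b = 'D_1 g c * (a - b).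
    by apply: W => // s; rewrite /between minC maxC; exact: dg.
  exists c; first by rewrite /between minC maxC.
  by rewrite -opprB e -mulrN opprB.
have bt s : (s \in `[a, b]) = between a b s.
  by rewrite in_itv /between (min_idPl ab) (max_idPr ab).
have [||c cab e] := @MVT_segment _ g ('D_1 g) a b ab.
- move=> s /subset_itv_oo_cc; rewrite bt => /dg h; exact: derivableP.
- by apply: derivable_within_continuous => s; rewrite bt => /dg.
- by exists c; rewrite -?bt.
Qed.

Lemma mean_value_u f a b v :
  (forall s, between a b s -> derivable f (s, v) e_u) ->
  exists2 c, between a b c & f (b, v) - f (a, v) = 'D_e_u f (c, v) * (b - a).
Proof.
move=> df; have [s /df/derivable_e_u //|c cab e] := @mean_value (fun s => f (s, v)) a b.
by exists c; rewrite // e derive_e_u.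
Qed.

Lemma mean_value_v f u a b :
  (forall s, between a b s -> derivable f (u, s) e_v) ->
  exists2 c, between a b c & f (u, b) - f (u, a) = 'D_e_v f (u, c) * (b - a).
Proof.
move=> df; have [s /df/derivable_e_v //|c cab e] := @mean_value (fun s => f (u, s)) a b.
by exists c; rewrite // e derive_e_v.
Qed.

Definition primitive_on (A : set (plane R)) (P Q F : plane R -> R) :=
  forall p, A p -> [/\ derivable F p e_u, derivable F p e_v,
                       'D_e_u F p = P p & 'D_e_v F p = Q p].

(** Two points of the intersection of two squares are joined inside it by an
    L-shaped path, so that the mean value theorem along the axes suffices. The
    increment of a local primitive thus does not depend on its choice. *)
Lemma primitive_unique (P Q F G : plane R -> R) p q r s (x y : plane R) :
  primitive_on (ball p r) P Q F -> primitive_on (ball q s) P Q G ->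
  ball p r x -> ball p r y -> ball q s x -> ball q s y ->
  F y - F x = G y - G x.
Proof.
move: x y => [x1 x2] [y1 y2] pF pG /ballP/=[? ?] /ballP/=[? ?] /ballP/=[? ?] /ballP/=[? ?].
pose K := F - G.
have pK z : ball p r z -> ball q s z ->
    [/\ derivable K z e_u, derivable K z e_v, 'D_e_u K z = 0 & 'D_e_v K z = 0].
  move=> /pF[fu fv eu ev] /pG[gu gv eu' ev']; split.
  - exact: derivableB.
  - exact: derivableB.
  - by rewrite deriveB // eu eu' subrr.
  - by rewrite deriveB // ev ev' subrr.
have bx t : between x1 y1 t -> ball p r (t, x2) /\ ball q s (t, x2).
  by move=> tb; split; apply/ballP; split=> //=; exact: between_dist tb.
have by' t : between x2 y2 t -> ball p r (y1, t) /\ ball q s (y1, t).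
  by move=> tb; split; apply/ballP; split=> //=; exact: between_dist tb.
have [t /bx[b1 b2]|c /bx[b1 b2] e1] := @mean_value_u K x1 y1 x2.
  by have [h _ _ _] := pK _ b1 b2; exact: h.
have [t /by'[b3 b4]|d /by'[b3 b4] e2] := @mean_value_v K y1 x2 y2.
  by have [_ h _ _] := pK _ b3 b4; exact: h.
have [_ _ z1 _] := pK _ b1 b2; have [_ _ _ z2] := pK _ b3 b4.
move: e1 e2; rewrite z1 z2 !mul0r /K !fctE => e1 e2; lra.
Qed.

(** The mean value theorem along an L-shaped path bounds the variation of f by
    that of its arguments, the partial derivatives being locally bounded. *)
Lemma continuous_of_partials f p :
  (\forall q \near p, derivable f q e_u /\ derivable f q e_v) ->
  {for p, continuous ('D_e_u f)} -> {for p, continuous ('D_e_v f)} ->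
  {for p, continuous f}.
Proof.
move=> df cu cv.
have lin (a b c : R) : 0 <= b -> `|a - c| <= 1 -> `|c| <= `|a| + b + 1.
  by have := ler_distD a 0 c; rewrite !sub0r !normrN; lra.
pose M := `|'D_e_u f p| + `|'D_e_v f p| + 1.
have M0 : 0 < M by rewrite ltr_wpDl // addr_ge0.
have [r /= r0 br] : nbhs_ball p (fun q => [/\ derivable f q e_u, derivable f q e_v,
    `|'D_e_u f q| <= M & `|'D_e_v f q| <= M]).
  rewrite -nbhs_ballP.
  move/cvgrPdist_le : cu => /(_ 1 ltr01) cu; move/cvgrPdist_le : cv => /(_ 1 ltr01) cv.
  apply: filterS3 df cu cv => q [fu fv] cu cv; split.
  - exact: fu.
  - exact: fv.
  - apply: lin; [exact: normr_ge0|exact: cu].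
  - rewrite /M [X in X + 1]addrC; apply: lin; [exact: normr_ge0|exact: cv].
apply/cvgrPdist_le => /= e e0.
suff : nbhs_ball p (fun q => `|f p - f q| <= e) by rewrite -nbhs_ballP.
exists (Num.min r (e / (2 * M))) => /=.
  by rewrite lt_min r0 divr_gt0 // mulr_gt0.
case: p {df cu cv lin} @M M0 br => [p1 p2] M M0 br [q1 q2] /ballP/=[].
rewrite !lt_min => /andP[h1 h1'] /andP[h2 h2'].
have b1 t : between p1 q1 t -> ball (p1, p2) r (t, p2).
  by move=> tb; apply/ballP; rewrite /= subrr normr0; split => //; apply: le_lt_trans (between_dist_le tb) h1.
have b2 t : between p2 q2 t -> ball (p1, p2) r (q1, t).
  by move=> tb; apply/ballP; split => //=; apply: le_lt_trans (between_dist_le tb) h2.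
have [t /b1/br[h _ _ _]|c /b1/br[_ _ m1 _] e1] := @mean_value_u f p1 q1 p2.
  exact: h.
have [t /b2/br[_ h _ _]|d /b2/br[_ _ _ m2] e2] := @mean_value_v f q1 p2 q2.
  exact: h.
have -> : f (p1, p2) - f (q1, q2) =
  - ('D_e_u f (c, p2) * (q1 - p1) + 'D_e_v f (q1, d) * (q2 - p2)) by rewrite -e1 -e2; ring.
rewrite normrN (le_trans (ler_normD _ _)) // !normrM.
rewrite (distrC q1) (distrC q2).
have hM : M * (e / (2 * M)) = e / 2 by field; rewrite gt_eqF.
rewrite [leRHS]splitr -hM lerD // ler_pM // ltW //.
Qed.

End Axes.

(** * Local primitives *)

Section LocalPrimitive.
Context {R : realType}.
Implicit Types (P Q f : plane R -> R) (p q : plane R).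

Lemma continuous_slice_u f u v :
  {for (u, v), continuous f} -> {for u, continuous (fun s => f (s, v))}.
Proof.
move=> fc; apply: (@continuous_comp _ _ _ (fun s => (s, v)) f) => //.
exact: (cvg_pair cvg_id (cvg_cst v)).
Qed.

Lemma continuous_slice_v f u v :
  {for (u, v), continuous f} -> {for v, continuous (fun s => f (u, s))}.
Proof.
move=> fc; apply: (@continuous_comp _ _ _ (fun s => (u, s)) f) => //.
exact: (cvg_pair (cvg_cst u) cvg_id).
Qed.

Lemma continuous_within_itv (g : R -> R) (a b : R) :
  (forall s, a <= s <= b -> {for s, continuous g}) -> {within `[a, b], continuous g}.
Proof.
by move=> gc; apply: continuous_in_subspaceT => s; rewrite inE /= in_itv /= => /gc.
Qed.

Lemma integrable_itv (g : R -> R) (a b : R) :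
  (forall s, a <= s <= b -> {for s, continuous g}) ->
  lebesgue_measure.-integrable `[a, b] (EFin \o g).
Proof.
move=> gc; apply: continuous_compact_integrable; first exact: segment_compact.
exact: continuous_within_itv.
Qed.

Lemma is_derive_integral (g : R -> R) (a b x : R) :
  (forall s, a <= s <= b -> {for s, continuous g}) -> a < x < b ->
  is_derive x 1 (fun y => \int[lebesgue_measure]_(t in `[a, y]) g t)%R (g x).
Proof.
move=> gc /andP[ax xb].
have gx : {for x, continuous g} by apply: gc; rewrite !ltW.
have [d e] := @continuous_FTC1_closed R g a x b xb (integrable_itv gc) ax gx.
by apply: DeriveDef; [exact: d|rewrite -derive1E; exact: e].
Qed.

Lemma integral_derive (g g' : R -> R) (a b : R) :
  a < b -> (forall s, a <= s <= b -> is_derive s 1 g (g' s)) ->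
  (forall s, a <= s <= b -> {for s, continuous g'}) ->
  (\int[lebesgue_measure]_(t in `[a, b]) g' t)%R = g b - g a.
Proof.
move=> ab dg gc.
have gcont s : a <= s <= b -> {for s, continuous g}.
  by move=> /dg[h _]; apply: differentiable_continuous; exact/derivable1_diffP.
rewrite /Rintegral (@continuous_FTC2 _ g' g a b ab) //.
- exact: continuous_within_itv.
- split.
  + move=> s; rewrite in_itv /= => /andP[h1 h2].
    by have [|h _] := dg s; rewrite ?ltW.
  + by apply: cvg_at_right_filter; apply: gcont; rewrite lexx ltW.
  + by apply: cvg_at_left_filter; apply: gcont; rewrite lexx ltW.
- move=> s; rewrite in_itv /= => /andP[h1 h2].
  by have [|_ h] := dg s; [rewrite !ltW|rewrite derive1E].
Qed.

(** Integrate P along the lower side of the square and then Q upwards: the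
    derivative in v is Q by the fundamental theorem. The derivative in u is taken
    under the integral sign, where Q_u = P_v integrates back to an increment of
    P. *)
Lemma local_primitive P Q p (e : R) : 0 < e ->
  (forall q, ball p e q -> {for q, continuous P}) ->
  (forall q, ball p e q -> {for q, continuous Q}) ->
  (forall q, ball p e q -> derivable P q e_v) ->
  (forall q, ball p e q -> derivable Q q e_u) ->
  (forall q, ball p e q -> {for q, continuous ('D_e_u Q)}) ->
  (forall q, ball p e q -> 'D_e_v P q = 'D_e_u Q q) ->
  exists F, primitive_on (ball p (e / 2)) P Q F.
Proof.
case: p => p1 p2 e0 cP cQ dP dQ cDQ PQ.
(* The integrals start from the lower left corner, so that their bounds are
   always in increasing order. *)
pose u0 := p1 - e / 2; pose u1 := p1 + e / 2.
pose v0 := p2 - e / 2; pose v1 := p2 + e / 2.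
have inb u v : u0 <= u <= u1 -> v0 <= v <= v1 -> ball (p1, p2) e (u, v).
  move: e0; rewrite /u0 /u1 /v0 /v1 => e0 /andP[? ?] /andP[? ?].
  by apply/ballP => /=; rewrite !ltr_norml; split; apply/andP; split; lra.
have v01 : v0 <= v0 <= v1 by rewrite lexx /v0 /v1 /=; lra.
pose M (uv : R * R) := (\int[lebesgue_measure]_(t in `[v0, uv.2]) Q (uv.1, t))%R.
pose F (uv : R * R) := (\int[lebesgue_measure]_(t in `[u0, uv.1]) P (t, v0))%R + M uv.
exists F => -[u v] /ballP /= [hu hv].
have {}hu : u0 < u < u1.
  by move: hu; rewrite /u0 /u1 ltr_norml => /andP[? ?]; apply/andP; split; lra.
have {}hv : v0 < v < v1.
  by move: hv; rewrite /v0 /v1 ltr_norml => /andP[? ?]; apply/andP; split; lra.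
have hu' : u0 <= u <= u1 by case/andP: hu => ? ?; rewrite !ltW.
have hvs s : v0 <= s <= v -> v0 <= s <= v1.
  by case/andP: hv => ? ? /andP[-> ?] /=; lra.
have Fv : is_derive v 1 (fun s => F (u, s)) (Q (u, v)).
  have Mv : is_derive v 1 (fun s => M (u, s)) (Q (u, v)).
    apply: (@is_derive_integral (fun t => Q (u, t)) v0 v1) => // s sv.
    by apply: continuous_slice_v; apply: cQ; exact: inb.
  pose c := (\int[lebesgue_measure]_(t in `[u0, u]) P (t, v0))%R.
  by have h := is_deriveD (is_derive_cst c v 1) Mv; rewrite add0r in h; exact: h.
have Fu1 : is_derive u 1 (fun s => \int[lebesgue_measure]_(t in `[u0, s]) P (t, v0))%R (P (u, v0)).
  apply: (@is_derive_integral (fun t => P (t, v0)) u0 u1) => // s su.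
  by apply: continuous_slice_u; apply: cP; exact: inb.
have [B [B0 hB]] : exists B, 0 <= B /\
    forall x y, u0 <= x <= u1 -> v0 <= y <= v1 -> `|'D_e_u Q (x, y)| <= B.
  have [|||c _ hc] := @compact_EVT_max _ R (fun q => `|'D_e_u Q q|) (`[u0, u1] `*` `[v0, v1]).
  - by exists (u0, v0); split; rewrite /= in_itv /= lexx /u0 /u1 /v0 /v1; lra.
  - by apply: compact_setX; exact: segment_compact.
  - apply: continuous_in_subspaceT => -[x y]; rewrite inE /= !in_itv /= => -[hx hy].
    apply: (@continuous_comp _ _ _ ('D_e_u Q) Num.norm); last exact: norm_continuous.
    by apply: cDQ; exact: inb.
  exists `|'D_e_u Q c|; split; first exact: normr_ge0.
  by move=> x y hx hy; apply: (hc (x, y)); rewrite inE; split; rewrite /= in_itv.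
have intQ x : `]u0, u1[%classic x ->
    lebesgue_measure.-integrable `[v0, v] (EFin \o (fun s => Q (x, s))).
  move=> /=; rewrite in_itv /= => /andP[? ?]; apply: integrable_itv => s /hvs ?.
  by apply: continuous_slice_v; apply: cQ; apply: inb; rewrite // !ltW.
have derQ x y : `]u0, u1[%classic x -> `[v0, v]%classic y -> derivable (fun s => Q (s, y)) x 1.
  rewrite /= !in_itv /= => /andP[? ?] /hvs ?.
  by apply/derivable_e_u; apply: dQ; apply: inb; rewrite // !ltW.
have Fu2 : is_derive u 1 (fun s => M (s, v)) (P (u, v) - P (u, v0)).
  have Iu : `]u0, u1[%classic u by rewrite /= in_itv.
  have intB : lebesgue_measure.-integrable `[v0, v] (EFin \o (fun=> B)).
    by apply: integrable_itv => s _; exact: cst_continuous.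
  have ubB x y : `]u0, u1[%classic x -> `[v0, v]%classic y ->
      `|partial1of2 (fun x y => Q (x, y)) x y| <= B.
    rewrite /= !in_itv /= => /andP[? ?] /hvs ?; rewrite partial1of2E -derive_e_u.
    by apply: hB; rewrite // !ltW.
  have d := @derivable_under_integral R _ _ lebesgue_measure (fun x y => Q (x, y))
    `[v0, v]%classic (measurable_itv _) u u0 u1 Iu intQ derQ (fun=> B) (fun=> B0) intB ubB.
  have E := @differentiation_under_integral R _ _ lebesgue_measure (fun x y => Q (x, y))
    `[v0, v]%classic (measurable_itv _) u u0 u1 Iu intQ derQ (fun=> B) (fun=> B0) intB ubB.
  apply: DeriveDef; first exact: d.
  rewrite -derive1E; apply: etrans E _.
  transitivity (\int[lebesgue_measure]_(y in `[v0, v]) 'D_e_u Q (u, y))%R.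
    by apply: eq_Rintegral => y _; rewrite partial1of2E -derive_e_u.
  apply: (@integral_derive (fun y => P (u, y)) (fun y => 'D_e_u Q (u, y)) v0 v).
  - by case/andP: hv.
  - move=> s /hvs sv; apply: DeriveDef.
      by apply/derivable_e_v; apply: dP; exact: inb.
    by rewrite -derive_e_v; apply: PQ; exact: inb.
  - move=> s /hvs sv.
    by apply: (@continuous_slice_v ('D_e_u Q)); apply: cDQ; exact: inb.
have Fu : is_derive u 1 (fun s => F (s, v)) (P (u, v)).
  have -> : P (u, v) = P (u, v0) + (P (u, v) - P (u, v0)) by rewrite addrC subrK.
  exact: is_deriveD.
split.
- by apply/derivable_e_u; have [d _] := Fu; exact: d.
- by apply/derivable_e_v; have [d _] := Fv; exact: d.
- by rewrite derive_e_u; have [_ d] := Fu; exact: d.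
- by rewrite derive_e_v; have [_ d] := Fv; exact: d.
Qed.

End LocalPrimitive.

(** * Monodromy: from locally exact to exact *)

(** A property that is locally constant along a connected set spreads from one of
    its points to all the others. *)
Lemma connected_near_iff (T : topologicalType) (A : set T) (S : T -> Prop) :
  connected A -> (forall x, A x -> \forall y \near x, A y -> (S x <-> S y)) ->
  forall x y, A x -> A y -> S x -> S y.
Proof.
move=> cA loc x y Ax Ay Sx.
suff /seteqP[_ /(_ y Ay)[]//] : A `&` S = A.
apply: cA; first by exists x.
- exists (interior [set z | A z -> S z]); first exact: open_interior.
  apply/seteqP; split=> z /= [Az].
    by move=> Sz; split=> //; apply: filterS (loc z Az) => w h /h [+ _]; exact.
  by move=> /nbhs_singleton /= h; split=> //; exact: h.
- exists (~` interior [set z | A z -> ~ S z]); first exact/open_closedC/open_interior.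
  apply/seteqP; split=> z /= [Az].
    by move=> Sz; split=> // /nbhs_singleton /= /(_ Az).
  move=> h; split=> //; apply: contrapT => nSz; apply: h.
  by apply: filterS (loc z Az) => w e /e [_ h] /h.
Qed.

Section Monodromy.
Context {R : realType}.
Variables (Sigma : set (plane R)) (P Q : plane R -> R).
Implicit Types (p q o : plane R) (g : R -> plane R) (Phi : R -> R).

Hypothesis locally_exact : forall p, Sigma p ->
  exists (r : R) F, [/\ 0 < r, ball p r `<=` Sigma & primitive_on (ball p r) P Q F].

Lemma ball_near o r p : ball o r p -> \forall q \near p, ball o r q.
Proof. by move=> h; apply: open_nbhs_nbhs; split=> //; exact: ball_open. Qed.

Lemma near_ball_continuous (T : topologicalType) (f : T -> plane R) (x : T) o r :
  {for x, continuous f} -> ball o r (f x) -> \forall y \near x, ball o r (f y).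
Proof. by move=> fc b; apply: fc; exact: ball_near. Qed.

(** The integral of the form from p to q along a path inside a small square; it
    is meaningful only when p and q lie in a common ball carrying a primitive. *)
Definition increment p q : R :=
  get [set c | exists o r F, [/\ primitive_on (ball o r) P Q F,
                                 ball o r p, ball o r q & c = F q - F p]].

Lemma incrementE o r F p q :
  primitive_on (ball o r) P Q F -> ball o r p -> ball o r q ->
  increment p q = F q - F p.
Proof.
move=> pF bp bq; rewrite /increment.
set S := [set c | _]; have : S (get S).
  by apply: getPex; exists (F q - F p), o, r, F.
by move=> [c [s [G [pG cp cq ->]]]]; exact: (primitive_unique pG pF).
Qed.

Lemma incrementxx p : Sigma p -> increment p p = 0.
Proof.
move=> /locally_exact[r [F [r0 _ pF]]].
by rewrite (incrementE pF (ballxx _ r0) (ballxx _ r0)) subrr.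
Qed.

(** Phi follows near t the integral of the form along g: the pair (g, Phi) is a
    path in the covering space of germs of primitives. *)
Definition lifts g Phi (t : R) := \forall s \near t, Phi s - Phi t = increment (g t) (g s).

Lemma lifts_unique g Phi Psi :
  (forall t, 0 <= t <= 1 -> lifts g Phi t) -> (forall t, 0 <= t <= 1 -> lifts g Psi t) ->
  Phi 1 - Phi 0 = Psi 1 - Psi 0.
Proof.
move=> lP lS; pose K t := Phi t - Psi t.
suff : K 1 = K 0 by rewrite /K; lra.
have [] : `[0, 1]%classic (0 : R) /\ `[0, 1]%classic (1 : R).
  by split; rewrite /= in_itv /= ?lexx ?ler01.
move=> h0 h1; have c01 := @segment_connected R 0 1.
apply: (@connected_near_iff _ _ (fun t => K t = K 0) c01 _ 0 1) => // t.
rewrite /= in_itv /= => t01; move: (lP _ t01) (lS _ t01).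
apply: filterS2 => s e1 e2 _; have -> : K s = K t by rewrite /K; lra.
by [].
Qed.

(** If the loop h s0 lifts to a closed path, its lift Phi is carried over to
    h s by adding at each time the increment from h s0 t to h s t. This makes
    sense for s close to s0 uniformly in t, by compactness of the interval. The
    construction is symmetric in s and s0, whence the equivalence. *)
Lemma lifts_deform (h : R -> R -> plane R) (s0 : R) :
  continuous (fun z : R * R => h z.1 z.2) -> (forall s t, Sigma (h s t)) ->
  (forall s, h s 1 = h s 0) ->
  let closes s := exists Phi, (forall t, 0 <= t <= 1 -> lifts (h s) Phi t) /\ Phi 0 = Phi 1 in
  \forall s \near s0, closes s0 <-> closes s.
Proof.
move=> hc hS hl closes.
have hct s t : {for t, continuous (h s)}.
  apply: (@continuous_comp _ _ _ (fun t => (s, t)) (fun z => h z.1 z.2)); last exact: hc.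
  exact: (cvg_pair (cvg_cst s) cvg_id).
pose good (s t : R) := exists o r F,
  [/\ primitive_on (ball o r) P Q F, ball o r (h s0 t) & ball o r (h s t)].
have goodP : \forall s \near s0, `[0, 1]%classic `<=` good s.
  have cov := (compact_near_coveringP _).1 (@segment_compact R 0 1).
  apply: (cov R (nbhs s0) good) => t _.
  have [r [F [r0 _ pF]]] := locally_exact (hS s0 t).
  have : \forall z \near (s0, t), ball (h s0 t) r (h z.1 z.2).
    by apply: (near_ball_continuous (f := fun z : R * R => h z.1 z.2)); [exact: hc|exact: ballxx].
  have : \forall t' \near t, ball (h s0 t) r (h s0 t') 
    by apply: near_ball_continuous; [exact: hct|exact: ballxx].
  move=> h1 [[U V] /= [hU hV] UV].
  exists (V `&` (fun t' => ball (h s0 t) r (h s0 t')), U).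
    by split=> //=; apply: filterI.
  by move=> [t' s] /= [[Vt' bt'] Us]; exists (h s0 t), r, F; split=> //; exact: (UV (s, t')).
apply: filterS goodP => s gs.
(* The four points h a t, h b t, h a t', h b t' lie in one ball, where increments
   are differences of values of a single primitive. *)
have transfer a b Phi : (forall t, 0 <= t <= 1 -> exists o r F,
     [/\ primitive_on (ball o r) P Q F, ball o r (h a t) & ball o r (h b t)]) ->
   (forall t, 0 <= t <= 1 -> lifts (h a) Phi t) -> Phi 0 = Phi 1 -> closes b.
  move=> gab lP P01; exists (fun t => Phi t + increment (h a t) (h b t)); split.
    move=> t t01; have [c [r [F [pF ba bb]]]] := gab t t01.
    have na : \forall t' \near t, ball c r (h a t') by exact: near_ball_continuous.
    have nb : \forall t' \near t, ball c r (h b t') by exact: near_ball_continuous.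
    apply: filterS3 (lP t t01) na nb => t' e ba' bb'.
    move: e; rewrite (incrementE pF ba bb) (incrementE pF ba' bb').
    rewrite (incrementE pF ba ba') (incrementE pF bb bb'); lra.
  by rewrite /= P01 !hl.
split=> -[Phi [lP P01]].
  by apply: (transfer s0 s Phi) => // t t01; apply: gs; rewrite /= in_itv.
apply: (transfer s s0 Phi) => // t t01.
have [c [r [F [pF b1 b2]]]] : good s t by apply: gs; rewrite /= in_itv.
by exists c, r, F.
Qed.

(** The retraction of the line onto the unit interval, written with absolute
    values to make its continuity immediate. *)
Definition clamp (t : R) : R := 2^-1 * (`|t| - `|t - 1| + 1).

Lemma clamp_le0 t : t <= 0 -> clamp t = 0.
Proof. by move=> t0; rewrite /clamp !ler0_norm; lra. Qed.

Lemma clamp_ge1 t : 1 <= t -> clamp t = 1.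
Proof. by move=> t1; rewrite /clamp !ger0_norm; lra. Qed.

Lemma clamp_id t : 0 <= t <= 1 -> clamp t = t.
Proof. by move=> /andP[t0 t1]; rewrite /clamp ger0_norm // ler0_norm; lra. Qed.

Lemma clamp_itv t : 0 <= clamp t <= 1.
Proof.
case: (leP t 0) => [/clamp_le0 ->|t0]; first by rewrite lexx ler01.
case: (leP 1 t) => [/clamp_ge1 ->|t1]; first by rewrite lexx ler01.
by rewrite clamp_id ltW //= ltW.
Qed.

Lemma continuous_clamp : continuous clamp.
Proof.
move=> t; apply: (@cvgM R R (nbhs t) _ (fun=> 2^-1)); first exact: cvg_cst.
apply: cvgD; last exact: cvg_cst.
apply: cvgB; first exact: norm_continuous.
apply: (@continuous_comp _ _ _ (fun x : R => x - 1) Num.norm); last exact: norm_continuous.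
by apply: cvgB; [exact: cvg_id|exact: cvg_cst].
Qed.

(** Some path from p to q has total increment c. Paths are parametrized by the
    whole line and constant outside the unit interval, which makes their
    concatenation a sum of functions rather than a definition by cases. *)
Definition joined p q (c : R) := exists g Phi,
  [/\ continuous g, forall t, Sigma (g t), forall t : R, t <= 0 -> g t = p /\ Phi t = 0,
      forall t : R, 1 <= t -> g t = q /\ Phi t = c & forall t, lifts g Phi t].

Lemma joined_sym p q c : joined p q c -> joined q p (- c).
Proof.
move=> [g [Phi [gc gS g0 g1 lP]]]; exists (fun t => g (1 - t)), (fun t => Phi (1 - t) - c).
have rev : continuous (fun t : R => 1 - t).
  by move=> t; apply: cvgB; [exact: cvg_cst|exact: cvg_id].
split=> [t|t|t t0|t t1|t].
- by apply: (@continuous_comp _ _ _ (fun t : R => 1 - t) g); [exact: rev|exact: gc].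
- exact: gS.
- by have [|-> ->] := g1 (1 - t); [lra|rewrite subrr].
- by have [|-> ->] := g0 (1 - t); [lra|rewrite sub0r].
- have n : \forall s \near t, Phi (1 - s) - Phi (1 - t) = increment (g (1 - t)) (g (1 - s)).
    exact: (rev t [set s | Phi s - Phi (1 - t) = increment (g (1 - t)) (g s)] (lP (1 - t))).
  by rewrite /lifts; apply: filterS n => s /= <-; ring.
Qed.

Lemma joined_trans p q r c d : joined p q c -> joined q r d -> joined p r (c + d).
Proof.
move=> [g [Phi [gc gS g0 g1 lP]]] [h [Psi [hc hS h0 h1 lS]]].
pose l t := g (2 * t) + h (2 * t - 1) - q.
pose Th t := Phi (2 * t) + Psi (2 * t - 1).
have dbl : continuous (fun t : R => 2 * t).
  by move=> t; apply: (@cvgM R R (nbhs t) _ (fun=> 2)); [exact: cvg_cst|exact: cvg_id].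
have dbl1 : continuous (fun t : R => 2 * t - 1).
  by move=> t; apply: cvgB; [exact: dbl|exact: cvg_cst].
have lE t : t <= 2^-1 -> l t = g (2 * t) /\ Th t = Phi (2 * t).
  move=> t2; rewrite /l /Th; have [|-> ->] := h0 (2 * t - 1); first lra.
  by rewrite addrK addr0.
have rE t : 2^-1 <= t -> l t = h (2 * t - 1) /\ Th t = c + Psi (2 * t - 1).
  move=> t2; rewrite /l /Th; have [|-> ->] := g1 (2 * t); first lra.
  by rewrite [q + _]addrC addrK.
have nl (t : R) : \forall s \near t, Phi (2 * s) - Phi (2 * t) = increment (g (2 * t)) (g (2 * s)).
  exact: (dbl t [set s | Phi s - Phi (2 * t) = increment (g (2 * t)) (g s)] (lP (2 * t))).
have nr (t : R) : \forall s \near t, Psi (2 * s - 1) - Psi (2 * t - 1) =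
    increment (h (2 * t - 1)) (h (2 * s - 1)).
  exact: (dbl1 t [set s | Psi s - Psi (2 * t - 1) = increment (h (2 * t - 1)) (h s)]
            (lS (2 * t - 1))).
exists l, Th; split=> [t|t|t t0|t t1|t].
- apply: cvgB; last exact: cvg_cst.
  apply: cvgD.
    by apply: (@continuous_comp _ _ _ (fun t : R => 2 * t) g); [exact: dbl|exact: gc].
  by apply: (@continuous_comp _ _ _ (fun t : R => 2 * t - 1) h); [exact: dbl1|exact: hc].
- by case: (leP t 2^-1) => [/lE[-> _]|/ltW/rE[-> _]].
- have [|-> ->] := lE t; first lra.
  by apply: g0; lra.
- have [|-> ->] := rE t; first lra.
  by have [|-> ->] := h1 (2 * t - 1); [lra|].
(* At the junction both halves start or end at q, and each side of t = 1/2 sees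
   one of them. *)
- case: (ltgtP t 2^-1) => [t2|t2|t2].
  + have n2 : \forall s \near t, s < 2^-1 by exact: lt_nbhsl.
    have [e1 e2] := lE t (ltW t2).
    rewrite /lifts e1 e2; apply: filterS2 (nl t) n2 => s /= e s2.
    by have [-> ->] := lE s (ltW s2).
  + have n2 : \forall s \near t, 2^-1 < s by exact: lt_nbhsr.
    have [e1 e2] := rE t (ltW t2).
    rewrite /lifts e1 e2; apply: filterS2 (nr t) n2 => s /= e s2.
    have [-> ->] := rE s (ltW s2); rewrite -e; ring.
  + rewrite /lifts; apply: filterS2 (nl t) (nr t) => s /=.
    have [|gq Pc] := g1 (2 * t); first by rewrite t2; lra.
    have [|hq Q0] := h0 (2 * t - 1); first by rewrite t2; lra.
    have [|-> ->] := lE t; first by rewrite t2.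
    rewrite gq Pc hq Q0 => e1 e2.
    case: (leP s 2^-1) => [/lE[-> ->]|/ltW/rE[-> ->]] //.
    by rewrite -e2; ring.
Qed.

Lemma joined_center p r F q : Sigma p -> ball p r `<=` Sigma -> primitive_on (ball p r) P Q F ->
  ball p r q -> joined p q (F q - F p).
Proof.
move=> Sp bS pF bq; pose g t := p + clamp t *: (q - p).
have bg t : ball p r (g t).
  move: bq; rewrite -!ball_normE /= /g opprD addNKr normrN normrZ distrC => bq.
  apply: le_lt_trans bq; apply: ler_piMl => //.
  by have /andP[c0 c1] := clamp_itv t; rewrite ger0_norm.
exists g, (fun t => F (g t) - F p); split=> [t|t|t t0|t t1|t].
- apply: cvgD; first exact: cvg_cst.
  by apply: continuousZl; exact: continuous_clamp.
- exact/bS/bg.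
- by rewrite /g clamp_le0 // scale0r addr0 subrr.
- by rewrite /g clamp_ge1 // scale1r addrC subrK.
- by rewrite /lifts; apply: filterS (near_ball t _ ltr01) => s _; rewrite (incrementE pF (bg t) (bg s)); ring.
Qed.

(** Along a null-homotopy the property of lifting to a closed path is locally
    constant in the parameter and holds for the final constant loop; hence it
    holds for the initial one, whose lift is unique up to a constant. *)
Lemma joined_loop p c : simply_connected_domain Sigma -> joined p p c -> c = 0.
Proof.
move=> [_ _ _ sc] [g [Phi [gc gS g0 g1 lP]]].
have [g00 P0] := g0 0 (lexx _); have [g11 P1] := g1 1 (lexx _).
have [||h [hc hS hs ht]] := sc g _ _ (etrans g00 (esym g11)).
- exact: continuous_subspaceT.
- by move=> _ [t _ <-].
(* The homotopy is only continuous within the square; composed with clamp it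
   becomes continuous on the whole plane. *)
pose k s t := h (clamp s, clamp t).
have cl2 t : `[0, 1]%classic (clamp t) by rewrite /= in_itv /= clamp_itv.
have cc : continuous (fun z : R * R => (clamp z.1, clamp z.2)).
  move=> z; have c1 : clamp y.1 @[y --> z] --> clamp z.1.
    by apply: (@continuous_comp _ _ _ fst clamp); [exact: cvg_fst|exact: continuous_clamp].
  have c2 : clamp y.2 @[y --> z] --> clamp z.2.
    by apply: (@continuous_comp _ _ _ snd clamp); [exact: cvg_snd|exact: continuous_clamp].
  exact: (cvg_pair c1 c2).
have kc : continuous (fun z : R * R => k z.1 z.2).
  move=> z; move/subspace_continuousP : hc => /(_ (clamp z.1, clamp z.2)) hz.
  have {}hz := hz (conj (cl2 _) (cl2 _)).
  apply: cvg_comp hz => A /= hA.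
  have n : \forall y \near z, (`[0, 1]%classic `*` `[0, 1]%classic) (clamp y.1, clamp y.2) ->
      A (clamp y.1, clamp y.2) by exact: (cc z _ hA).
  by apply: filterS n => y; apply; split; exact: cl2.
have kS s t : Sigma (k s t).
  by apply: hS; exists (clamp s, clamp t) => //; split; exact: cl2.
have clt t : clamp t \in `[0, 1] by rewrite in_itv /= clamp_itv.
have kl s : k s 1 = k s 0.
  by rewrite /k (clamp_ge1 (lexx _)) (clamp_le0 (lexx _)); have [-> ->] := ht _ (clt s).
have h0 : `[0, 1]%classic (0 : R) by rewrite /= in_itv /= lexx ler01.
have h1 : `[0, 1]%classic (1 : R) by rewrite /= in_itv /= lexx ler01.
have [||Psi [lS Psi01]] := @connected_near_iff _ _
  (fun s => exists Phi, (forall t, 0 <= t <= 1 -> lifts (k s) Phi t) /\ Phi 0 = Phi 1)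
  (@segment_connected R 0 1) _ 1 0 h1 h0 _.
- move=> s0 _; have := lifts_deform s0 kc kS kl.
  by apply: filterS => s.
- exists (fun=> 0); split=> // t _.
  rewrite /lifts; apply: filterS (near_ball t _ ltr01) => s _; rewrite subrr /k clamp_ge1 //.
  have [_ ->] := hs _ (clt t); have [_ ->] := hs _ (clt s).
  by rewrite incrementxx.
- have kg : k 0 = g.
    apply/funext => t; rewrite /k clamp_le0 //; have [-> _] := hs _ (clt t).
    case: (leP t 0) => [t0|t0].
      by rewrite clamp_le0 // g00; have [->] := g0 t t0.
    case: (leP 1 t) => [t1|t1].
      by rewrite clamp_ge1 // g11; have [->] := g1 t t1.
    by rewrite clamp_id // ltW //= ltW.
  rewrite kg in lS.
  have := lifts_unique (fun t _ => lP t) lS.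
  by rewrite P0 P1 Psi01 subrr subr0.
Qed.

(** The value at p is the total increment of any path from a base point to p:
    loops have increment zero, so the choice of the path is immaterial, and near p
    the function differs from a local primitive by a constant. *)
Theorem exact_of_locally_exact : simply_connected_domain Sigma ->
  exists F, primitive_on Sigma P Q F.
Proof.
move=> sc; have [Sopen [p0 Sp0] Sconn _] := sc.
have near_joined p : Sigma p -> exists r F,
    [/\ 0 < r, primitive_on (ball p r) P Q F & forall q, ball p r q -> joined p q (F q - F p)].
  move=> Sp; have [r [F [r0 bS pF]]] := locally_exact Sp.
  by exists r, F; split=> // q; exact: joined_center.
have reach p : Sigma p -> exists c, joined p0 p c.
  move=> Sp; apply: (@connected_near_iff _ _ (fun p => exists c, joined p0 p c) Sconn _ p0 p) => //.
    move=> q /near_joined[r [F [r0 _ jF]]].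
    apply: filterS (near_ball q _ r0) => q' /jF j _; split=> -[c jc].
      by eexists; exact: joined_trans jc j.
    by eexists; exact: joined_trans jc (joined_sym j).
  have [r [F [r0 _ jF]]] := near_joined p0 Sp0.
  by eexists; apply: jF; exact: ballxx.
pose G p := get (joined p0 p).
have GP p : Sigma p -> joined p0 p (G p) by move=> /reach; exact: getPex.
exists G => p Sp; have [r [F [r0 pF jF]]] := near_joined p Sp.
have GF : \forall q \near p, G q = F q + (G p - F p).
  have nS : \forall q \near p, Sigma q by exact: (open_nbhs_nbhs (conj Sopen Sp)).
  apply: filterS2 (near_ball p _ r0) nS => q /jF j Sq.
  have := joined_loop sc (joined_trans (joined_trans (GP p Sp) j) (joined_sym (GP q Sq))).
  lra.
have FG : \forall q \near p, F q + (G p - F p) = G q by apply: filterS GF => q ->.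
have [du dv eu ev] := pF p (ballxx _ r0).
split.
- apply: near_eq_derivable FG _; apply: derivableD; [exact: du|exact: derivable_cst].
- apply: near_eq_derivable FG _; apply: derivableD; [exact: dv|exact: derivable_cst].
- rewrite (near_eq_derive e_u GF) deriveD; [|exact: du|exact: derivable_cst].
  by rewrite derive_cst addr0.
- rewrite (near_eq_derive e_v GF) deriveD; [|exact: dv|exact: derivable_cst].
  by rewrite derive_cst addr0.
Qed.

End Monodromy.

(** * Smooth functions of two variables *)

Section Schwarz.
Context {R : realType}.
Implicit Types (f : plane R -> R) (p q : plane R).

(** Both mixed derivatives are limits of the same second difference divided by
    the area h^2 of a small square. If they differed at p, two values of mixed
    derivatives near p given by the mean value theorem would be equal and yet
    closer to distinct limits than half their distance. *)
Lemma derive_comm f p :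
  (\forall q \near p, [/\ derivable f q e_u, derivable f q e_v,
     derivable ('D_e_u f) q e_v & derivable ('D_e_v f) q e_u]) ->
  {for p, continuous ('D_e_v ('D_e_u f))} -> {for p, continuous ('D_e_u ('D_e_v f))} ->
  'D_e_v ('D_e_u f) p = 'D_e_u ('D_e_v f) p.
Proof.
move=> df cvu cuv; apply/eqP; rewrite -subr_eq0; apply/negP => /negP.
rewrite -normr_gt0; set X := 'D_e_v _ p; set Y := 'D_e_u _ p => XY0.
have e0 : 0 < `|X - Y| / 2 by rewrite divr_gt0.
have [r /= r0 br] : nbhs_ball p (fun q =>
    ([/\ derivable f q e_u, derivable f q e_v,
     derivable ('D_e_u f) q e_v & derivable ('D_e_v f) q e_u] /\
     `|X - 'D_e_v ('D_e_u f) q| < `|X - Y| / 2) /\ `|Y - 'D_e_u ('D_e_v f) q| < `|X - Y| / 2).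
  rewrite -nbhs_ballP; apply: filterI; first apply: filterI df _.
    by move/cvgrPdist_lt : cvu; apply.
  by move/cvgrPdist_lt : cuv; apply.
case: p {df cvu cuv} @X @Y XY0 e0 br => a b X Y XY0 e0 br.
pose h := r / 2; have h0 : 0 < h by rewrite divr_gt0.
have hr : h < r by rewrite /h; lra.
have inb s t : between a (a + h) s -> between b (b + h) t -> ball (a, b) r (s, t).
  move=> /between_dist_le ds /between_dist_le dt.
  have hE c : `|c - (c + h)| = h by rewrite opprD addNKr normrN gtr0_norm.
  by rewrite !hE in ds dt; apply/ballP; split=> /=; [apply: le_lt_trans ds hr|apply: le_lt_trans dt hr].
have ba : between a (a + h) a by rewrite /between ge_min le_max lexx.
have bb : between b (b + h) b by rewrite /between ge_min le_max lexx.
have bah : between a (a + h) (a + h) by rewrite /between ge_min le_max lexx !orbT.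
have bbh : between b (b + h) (b + h) by rewrite /between ge_min le_max lexx !orbT.
have hh c : c + h - c = h by rewrite addrAC subrr add0r.
have fu s t : between a (a + h) s -> between b (b + h) t ->
    is_derive s 1 (fun s => f (s, t)) ('D_e_u f (s, t)).
  move=> hs ht; have [[[d _ _ _] _] _] := br _ (inb _ _ hs ht).
  by rewrite derive_e_u; apply: derivableP; exact/derivable_e_u.
have fv s t : between a (a + h) s -> between b (b + h) t ->
    is_derive t 1 (fun t => f (s, t)) ('D_e_v f (s, t)).
  move=> hs ht; have [[[_ d _ _] _] _] := br _ (inb _ _ hs ht).
  by rewrite derive_e_v; apply: derivableP; exact/derivable_e_v.
pose A := f (a + h, b + h) - f (a + h, b) - (f (a, b + h) - f (a, b)).
have [Xc hX AX] : exists2 Xc, `|X - Xc| < `|X - Y| / 2 & A = Xc * h * h.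
  have dphi s : between a (a + h) s ->
      is_derive s 1 (fun s => f (s, b + h) - f (s, b)) ('D_e_u f (s, b + h) - 'D_e_u f (s, b)).
    by move=> hs; apply: is_deriveB; exact: fu.
  have [s /dphi[d _]|c hc e] := @mean_value _ (fun s => f (s, b + h) - f (s, b)) a (a + h).
    exact: d.
  have [_ e'] := dphi c hc; rewrite e' hh in e.
  have [t ht|d hd e2] := @mean_value_v _ ('D_e_u f) c b (b + h).
    by have [[[_ _ h' _] _] _] := br _ (inb _ _ hc ht); exact: h'.
  have [[_ h'] _] := br _ (inb _ _ hc hd).
  by exists ('D_e_v ('D_e_u f) (c, d)); [exact: h'|rewrite /A e e2 hh].
have [Yc hY AY] : exists2 Yc, `|Y - Yc| < `|X - Y| / 2 & A = Yc * h * h.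
  have dphi t : between b (b + h) t ->
      is_derive t 1 (fun t => f (a + h, t) - f (a, t)) ('D_e_v f (a + h, t) - 'D_e_v f (a, t)).
    by move=> ht; apply: is_deriveB; exact: fv.
  have [t /dphi[d _]|d hd e] := @mean_value _ (fun t => f (a + h, t) - f (a, t)) b (b + h).
    exact: d.
  have [_ e'] := dphi d hd; rewrite e' hh in e.
  have [s hs|c hc e2] := @mean_value_u _ ('D_e_v f) a (a + h) d.
    by have [[[_ _ _ h'] _] _] := br _ (inb _ _ hs hd); exact: h'.
  have [_ h'] := br _ (inb _ _ hc hd).
  exists ('D_e_u ('D_e_v f) (c, d)); first exact: h'.
  rewrite /A -[RHS](_ : f (a + h, b + h) - f (a, b + h) - (f (a + h, b) - f (a, b)) = _).
    ring.
  by rewrite e e2 hh.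
have XYc : Xc = Yc.
  have hn0 : h != 0 by rewrite gt_eqF.
  by apply: (mulIf hn0); apply: (mulIf hn0); rewrite -AX -AY.
move: X Y {XY0 br AX AY e0} hX hY => X Y hX hY; rewrite -XYc distrC in hY.
by have := ler_distD Xc X Y; lra.
Qed.

End Schwarz.

Section SmoothCalculus.
Context {R : realType} {Sigma : set (plane R)}.
Hypothesis Sigma_open : open Sigma.

Local Notation cd := continuously_differentiable.

Definition coordinate_direction (w : plane R) := w = e_u \/ w = e_v.

Section General.
Variable W : normedModType R.
Implicit Types f g : plane R -> W.

Lemma near_in_open p : Sigma p -> \forall q \near p, Sigma q.
Proof. by move=> Sp; exact: (open_nbhs_nbhs (conj Sigma_open Sp)). Qed.

(** This form of the inductive clause treats the two directions uniformly. *)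
Lemma cdSP n f : cd n.+1 Sigma f <->
  (forall p, Sigma p -> {for p, continuous f}) /\
  forall w, coordinate_direction w ->
    (forall p, Sigma p -> derivable f p w) /\ cd n Sigma ('D_w f).
Proof.
split=> /=.
  move=> [fc [fd fu fv]]; split=> // w [->|->]; split.
  - by move=> p /fd[].
  - exact: fu.
  - by move=> p /fd[].
  - exact: fv.
move=> [fc fd]; have [du fu] := fd _ (or_introl erefl); have [dv fv] := fd _ (or_intror erefl).
split=> //; split; [|exact: fu|exact: fv].
by move=> p Sp; split; [exact: du|exact: dv].
Qed.

Lemma cd_continuous n f p : cd n Sigma f -> Sigma p -> {for p, continuous f}.
Proof. by case: n => [|n] [fc _]; exact: fc. Qed.

Lemma cd_congr n f g : (forall p, Sigma p -> f p = g p) -> cd n Sigma f -> cd n Sigma g.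
Proof.
elim: n f g => [|n IH] f g fg.
  move=> [fc _]; split=> // p Sp; have nfg : {near p, f =1 g}.
    by apply: filterS (near_in_open Sp) => q /fg.
  rewrite /prop_for /continuous_at -fg //.
  by apply: cvg_trans (fc p Sp); exact: near_eq_cvg.
have nfg p : Sigma p -> {near p, f =1 g}.
  by move=> Sp; apply: filterS (near_in_open Sp) => q /fg.
move=> /cdSP[fc fd]; apply/cdSP; split=> [p Sp|w /fd[dw fw]].
  rewrite /prop_for /continuous_at -fg //.
  by apply: cvg_trans (fc p Sp); apply: near_eq_cvg; exact: nfg.
split=> [p Sp|]; first by apply: near_eq_derivable (nfg p Sp) _; exact: dw.
by apply: IH fw => p Sp; apply: near_eq_derive; exact: nfg.
Qed.

Lemma cd_le n f : cd n.+1 Sigma f -> cd n Sigma f.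
Proof.
elim: n f => [|n IH] f; first by move=> [fc _]; split.
by move=> /cdSP[fc fd]; apply/cdSP; split=> // w /fd[dw /IH fw].
Qed.

Lemma smooth_congr f g : (forall p, Sigma p -> f p = g p) -> smooth Sigma f -> smooth Sigma g.
Proof. by move=> fg fs n; exact: cd_congr fg (fs n). Qed.

Lemma smooth_continuous f p : smooth Sigma f -> Sigma p -> {for p, continuous f}.
Proof. by move=> fs Sp; exact: cd_continuous (fs 0) Sp. Qed.

Lemma smooth_derivable f p w : smooth Sigma f -> coordinate_direction w -> Sigma p ->
  derivable f p w.
Proof. by move=> fs wP Sp; have /cdSP[_ fd] := fs 1%N; have [d _] := fd w wP; exact: d. Qed.

Lemma smooth_derive f w : smooth Sigma f -> coordinate_direction w -> smooth Sigma ('D_w f).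
Proof. by move=> fs wP n; have /cdSP[_ fd] := fs n.+1; have [_ d] := fd w wP; exact: d. Qed.

Lemma smooth_partials f : (forall p, Sigma p -> {for p, continuous f}) ->
  (forall w, coordinate_direction w ->
     (forall p, Sigma p -> derivable f p w) /\ smooth Sigma ('D_w f)) ->
  smooth Sigma f.
Proof.
move=> fc fd [|n]; first by split.
by apply/cdSP; split=> // w /fd[d s]; split=> //; exact: s.
Qed.

Lemma smooth_cst (c : W) : smooth Sigma (fun=> c).
Proof.
move=> n; elim: n c => [|n IH] c; first by split=> // p _; exact: cst_continuous.
apply/cdSP; split=> [p _|w _]; first exact: cst_continuous.
split=> [p _|]; first exact: derivable_cst.
by apply: cd_congr (IH 0) => p _; rewrite derive_cst.
Qed.

End General.

Section Real.
Implicit Types f g : plane R -> R.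

Lemma cdD n f g : cd n Sigma f -> cd n Sigma g -> cd n Sigma (fun p => f p + g p).
Proof.
elim: n f g => [|n IH] f g.
  by move=> [fc _] [gc _]; split=> // p Sp; apply: cvgD; [exact: fc|exact: gc].
move=> /cdSP[fc fd] /cdSP[gc gd]; apply/cdSP; split=> [p Sp|w wP].
  by apply: cvgD; [exact: fc|exact: gc].
have [df cf] := fd w wP; have [dg cg] := gd w wP.
split=> [p Sp|]; first by apply: derivableD; [exact: df|exact: dg].
apply: cd_congr (IH _ _ cf cg) => p Sp.
by rewrite -deriveD; [|exact: df|exact: dg].
Qed.

Lemma cdM n f g : cd n Sigma f -> cd n Sigma g -> cd n Sigma (fun p => f p * g p).
Proof.
elim: n f g => [|n IH] f g.
  by move=> [fc _] [gc _]; split=> // p Sp; apply: cvgM; [exact: fc|exact: gc].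
move=> cf cg; have := cf; have := cg; move=> /cdSP[gc gd] /cdSP[fc fd].
apply/cdSP; split=> [p Sp|w wP].
  by apply: cvgM; [exact: fc|exact: gc].
have [df cdf] := fd w wP; have [dg cdg] := gd w wP.
split=> [p Sp|]; first by apply: derivableM; [exact: df|exact: dg].
apply: cd_congr (cdD (IH _ _ (cd_le cf) cdg) (IH _ _ (cd_le cg) cdf)) => p Sp.
by rewrite deriveM; [|exact: df|exact: dg].
Qed.

Lemma smoothD f g : smooth Sigma f -> smooth Sigma g -> smooth Sigma (fun p => f p + g p).
Proof. by move=> fs gs n; apply: cdD; [exact: fs|exact: gs]. Qed.

Lemma smoothM f g : smooth Sigma f -> smooth Sigma g -> smooth Sigma (fun p => f p * g p).
Proof. by move=> fs gs n; apply: cdM; [exact: fs|exact: gs]. Qed.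

Lemma smoothN f : smooth Sigma f -> smooth Sigma (fun p => - f p).
Proof.
move=> fs; have h := smoothM (@smooth_cst _ (-1 : R)) fs; apply: smooth_congr h => p _.
by rewrite mulN1r.
Qed.

Lemma smoothB f g : smooth Sigma f -> smooth Sigma g -> smooth Sigma (fun p => f p - g p).
Proof. by move=> fs gs; apply: smoothD => //; exact: smoothN. Qed.

Lemma smoothV f : (forall p, Sigma p -> f p != 0) -> smooth Sigma f ->
  smooth Sigma (fun p => (f p)^-1).
Proof.
move=> f0 fs n; have fc p : Sigma p -> {for p, continuous (fun p => (f p)^-1)}.
  by move=> Sp; apply: cvgV; [exact: f0|exact: smooth_continuous fs Sp].
elim: n => [|n IH]; first by split.
apply/cdSP; split=> // w wP; split=> [p Sp|].
  by apply: derivableV; [exact: f0|exact: smooth_derivable fs wP Sp].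
have h : cd n Sigma (fun p => - 1 * ((f p)^-1 * (f p)^-1 * 'D_w f p)).
  apply: cdM; first exact: smooth_cst.
  apply: cdM; first exact: cdM.
  exact: smooth_derive.
apply: cd_congr h => p Sp.
rewrite deriveV; [|exact: f0|exact: smooth_derivable fs wP Sp].
by rewrite /GRing.scale /= mulN1r mulNr -exprVn expr2.
Qed.

Lemma smooth_ln f : (forall p, Sigma p -> 0 < f p) -> smooth Sigma f ->
  smooth Sigma (fun p => ln (f p)).
Proof.
move=> f0 fs.
have dln p w : Sigma p -> coordinate_direction w ->
    is_derive p w (fun p => ln (f p)) ((f p)^-1 * 'D_w f p).
  move=> Sp wP; have df := smooth_derivable fs wP Sp.
  pose g (h : R) := f (h *: w + p).
  have g0 : g 0 = f p by rewrite /g scale0r add0r.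
  have dg : is_derive (0 : R) (1 : R) g ('D_w f p).
    by apply/is_derive1_line; exact: derivableP.
  have dl : is_derive (g 0) 1 (@ln R) (g 0)^-1 by apply: is_derive1_ln; rewrite g0 f0.
  rewrite -g0; apply/is_derive1_line; exact: is_derive1_comp.
apply: smooth_partials => [p Sp|w wP].
  apply: (@continuous_comp _ _ _ f (@ln R)); first exact: smooth_continuous fs Sp.
  by apply: continuous_ln; exact: f0.
split=> [p Sp|]; first by have [d _] := dln p w Sp wP; exact: d.
have h : smooth Sigma (fun p => (f p)^-1 * 'D_w f p).
  apply: smoothM; last exact: smooth_derive.
  by apply: smoothV => // p Sp; rewrite gt_eqF // f0.
by apply: smooth_congr h => p Sp; have [_ e] := dln p w Sp wP; rewrite e.
Qed.

End Real.
End SmoothCalculus.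

Section DeriveRules.
Context {R : realType}.
Implicit Types (f g : plane R -> R) (p w : plane R).

Lemma is_derive_add f g p w df dg : is_derive p w f df -> is_derive p w g dg ->
  is_derive p w (fun q => f q + g q) (df + dg).
Proof. by move=> hf hg; exact: is_deriveD. Qed.

Lemma is_derive_sub f g p w df dg : is_derive p w f df -> is_derive p w g dg ->
  is_derive p w (fun q => f q - g q) (df - dg).
Proof. by move=> hf hg; exact: is_deriveB. Qed.

Lemma is_derive_mul f g p w df dg : is_derive p w f df -> is_derive p w g dg ->
  is_derive p w (fun q => f q * g q) (df * g p + f p * dg).
Proof.
move=> hf hg; have h := is_deriveM hf hg.
by apply: is_derive_eq h _; rewrite addrC /GRing.scale /= [g p * _]mulrC.
Qed.

Lemma is_derive_cmul (c : R) f p w df : is_derive p w f df ->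
  is_derive p w (fun q => c * f q) (c * df).
Proof.
move=> hf; have h := is_derive_mul (is_derive_cst c p w) hf.
by apply: is_derive_eq h _; rewrite mul0r add0r.
Qed.

End DeriveRules.

(** * The Poincare lemma for smooth forms *)

Section SmoothOnOpen.
Context {R : realType} {Sigma : set (plane R)}.
Hypothesis Sigma_open : open Sigma.
Implicit Types (f g P Q : plane R -> R) (p w : plane R).

Lemma dir_u : coordinate_direction (e_u : plane R). Proof. by left. Qed.
Lemma dir_v : coordinate_direction (e_v : plane R). Proof. by right. Qed.

Lemma derive_congr f g p w : (forall q, Sigma q -> f q = g q) -> Sigma p ->
  'D_w f p = 'D_w g p.
Proof.
move=> fg Sp; apply: near_eq_derive.
by apply: filterS (near_in_open Sigma_open Sp) => q; exact: fg.
Qed.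

Lemma smooth_is_derive f p w : smooth Sigma f -> coordinate_direction w -> Sigma p ->
  is_derive p w f ('D_w f p).
Proof. by move=> fs wP Sp; apply: derivableP; exact: smooth_derivable fs wP Sp. Qed.

Lemma smooth_derive_comm f p : smooth Sigma f -> Sigma p ->
  'D_e_v ('D_e_u f) p = 'D_e_u ('D_e_v f) p.
Proof.
move=> fs Sp; have fus := smooth_derive fs dir_u; have fvs := smooth_derive fs dir_v.
apply: derive_comm.
- apply: filterS (near_in_open Sigma_open Sp) => q Sq; split.
  + exact: smooth_derivable fs dir_u Sq.
  + exact: smooth_derivable fs dir_v Sq.
  + exact: smooth_derivable fus dir_v Sq.
  + exact: smooth_derivable fvs dir_u Sq.
- exact: smooth_continuous (smooth_derive fus dir_v) Sp.
- exact: smooth_continuous (smooth_derive fvs dir_u) Sp.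
Qed.

Lemma smooth_primitive_on P Q F : primitive_on Sigma P Q F ->
  smooth Sigma P -> smooth Sigma Q -> smooth Sigma F.
Proof.
move=> pF Ps Qs.
have Fu : smooth Sigma ('D_e_u F).
  by apply: (smooth_congr Sigma_open _ Ps) => p /pF[_ _ e _]; rewrite e.
have Fv : smooth Sigma ('D_e_v F).
  by apply: (smooth_congr Sigma_open _ Qs) => p /pF[_ _ _ e]; rewrite e.
apply: smooth_partials => [p Sp|w [->|->]].
- apply: continuous_of_partials.
  + by apply: filterS (near_in_open Sigma_open Sp) => q /pF[du dv _ _]; split; [exact: du|exact: dv].
  + exact: smooth_continuous Fu Sp.
  + exact: smooth_continuous Fv Sp.
- by split; [move=> p /pF[d _ _ _]; exact: d|exact: Fu].
- by split; [move=> p /pF[_ d _ _]; exact: d|exact: Fv].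
Qed.

Theorem poincare P Q : simply_connected_domain Sigma ->
  smooth Sigma P -> smooth Sigma Q ->
  (forall p, Sigma p -> 'D_e_v P p = 'D_e_u Q p) ->
  exists F, smooth Sigma F /\ primitive_on Sigma P Q F.
Proof.
move=> sc Ps Qs PQ.
have [p Sp|F pF] := @exact_of_locally_exact R Sigma P Q _ sc; last first.
  by exists F; split=> //; exact: smooth_primitive_on pF Ps Qs.
have [e /= e0 be] : nbhs_ball p Sigma by rewrite -nbhs_ballP; exact: near_in_open.
have [] := @local_primitive R P Q p e e0.
- by move=> q /be Sq; exact: smooth_continuous Ps Sq.
- by move=> q /be Sq; exact: smooth_continuous Qs Sq.
- by move=> q /be Sq; exact: smooth_derivable Ps dir_v Sq.
- by move=> q /be Sq; exact: smooth_derivable Qs dir_u Sq.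
- by move=> q /be Sq; exact: smooth_continuous (smooth_derive Qs dir_u) Sq.
- by move=> q /be; exact: PQ.
move=> F pF; exists (e / 2), F; split; first by rewrite divr_gt0.
  by apply: subset_trans be; apply: le_ball; lra.
exact: pF.
Qed.

Section Matrices.
Variables m n : nat.
Implicit Types x : plane R -> 'M[R]_(m, n).

Lemma derive_entry x p w i j : derivable x p w ->
  ('D_w x p) i j = 'D_w (fun q => x q i j) p.
Proof. by move=> d; rewrite derive_mx // mxE. Qed.

Lemma continuous_mx (T : topologicalType) (F : T -> 'M[R]_(m, n)) (t : T) :
  (forall i j, {for t, continuous (fun s => F s i j)}) -> {for t, continuous F}.
Proof.
move=> Fc; apply/cvgrPdist_le => /= e e0; near=> s.
rewrite [leLHS]/Num.Def.normr /= mx_normrE (bigmax_le _ (ltW e0)) //= => i _.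
rewrite !mxE; move: i; near: s; apply: filter_forall => /= i.
by have /cvgrPdist_le := Fc i.1 i.2; apply.
Unshelve. all: by end_near. Qed.

Lemma smooth_entry x i j : smooth Sigma x -> smooth Sigma (fun p => x p i j).
Proof.
suff H k (y : plane R -> 'M[R]_(m, n)) : continuously_differentiable k Sigma y ->
    continuously_differentiable k Sigma (fun p => y p i j).
  by move=> xs k; apply: H; exact: xs.
elim: k y => [|k IH] y.
  move=> [yc _]; split=> // p Sp.
  apply: (@continuous_comp _ _ _ y (fun M : 'M[R]_(m, n) => M i j)); first exact: yc.
  exact: coord_continuous.
move=> /cdSP[yc yd]; apply/cdSP; split=> [p Sp|w /yd[dy cy]].
  apply: (@continuous_comp _ _ _ y (fun M : 'M[R]_(m, n) => M i j)); first exact: yc.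
  exact: coord_continuous.
split=> [p Sp|]; first by have /derivable_mxP := dy p Sp; exact.
apply: (cd_congr Sigma_open _ (IH _ cy)) => p Sp.
by rewrite derive_entry //; exact: dy.
Qed.

Lemma smooth_of_entries x : (forall i j, smooth Sigma (fun p => x p i j)) -> smooth Sigma x.
Proof.
suff H k (y : plane R -> 'M[R]_(m, n)) : (forall i j, continuously_differentiable k Sigma (fun p => y p i j)) ->
    continuously_differentiable k Sigma y.
  by move=> xs k; apply: H => i j; exact: xs.
elim: k y => [|k IH] y yij.
  by split=> // p Sp; apply: continuous_mx => i j; have [yc _] := yij i j; exact: yc.
apply/cdSP; split=> [p Sp|w wP].
  apply: continuous_mx => i j; exact: cd_continuous (yij i j) Sp.
have dy p : Sigma p -> derivable y p w.
  move=> Sp; apply/derivable_mxP => i j.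
  by have /cdSP[_ yd] := yij i j; have [d _] := yd w wP; exact: d.
split=> //; apply: IH => i j; have /cdSP[_ yd] := yij i j; have [_ c] := yd w wP.
by apply: (cd_congr Sigma_open _ c) => p Sp; rewrite derive_entry //; exact: dy.
Qed.

End Matrices.
End SmoothOnOpen.

(** * Complex matrices of size two *)

Section Matrix2.

Lemma ord2P (i : 'I_2) : i = 0 \/ i = 1.
Proof. by case: i => [[|[|//]] h]; [left|right]; apply: val_inj. Qed.

Lemma mx2_inj (T : Type) (a b c d a' b' c' d' : T) : mx2 a b c d = mx2 a' b' c' d' ->
  [/\ a = a', b = b', c = c' & d = d'].
Proof.
by move=> /matrixP e; split; [have := e 0 0|have := e 0 1|have := e 1 0|have := e 1 1]; rewrite !mxE.
Qed.

Lemma mul_mx2 (K : pzRingType) (a b c d a' b' c' d' : K) :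
  mx2 a b c d *m mx2 a' b' c' d' =
  mx2 (a * a' + b * c') (a * b' + b * d') (c * a' + d * c') (c * b' + d * d').
Proof.
apply/matrixP => i j; rewrite !mxE big_ord_recl big_ord1 !mxE /=.
by case: (ord2P i) => ->; case: (ord2P j) => ->.
Qed.

Lemma sub_mx2 (K : zmodType) (a b c d a' b' c' d' : K) :
  mx2 a b c d - mx2 a' b' c' d' = mx2 (a - a') (b - b') (c - c') (d - d').
Proof.
by apply/matrixP => i j; rewrite !mxE; case: (ord2P i) => ->; case: (ord2P j) => ->.
Qed.

Lemma opp_mx2 (K : zmodType) (a b c d : K) : - mx2 a b c d = mx2 (- a) (- b) (- c) (- d).
Proof.
by apply/matrixP => i j; rewrite !mxE; case: (ord2P i) => ->; case: (ord2P j) => ->.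
Qed.

Lemma scale_mx2 (K : pzRingType) (k a b c d : K) :
  k *: mx2 a b c d = mx2 (k * a) (k * b) (k * c) (k * d).
Proof.
by apply/matrixP => i j; rewrite !mxE; case: (ord2P i) => ->; case: (ord2P j) => ->.
Qed.

Lemma zero_mx2 (K : zmodType) : (0 : 'M[K]_2) = mx2 0 0 0 0.
Proof.
by apply/matrixP => i j; rewrite !mxE; case: (ord2P i) => ->; case: (ord2P j) => ->.
Qed.

Lemma det_mx2 (K : comPzRingType) (a b c d : K) : \det (mx2 a b c d) = a * d - b * c.
Proof.
rewrite (expand_det_row _ 0) big_ord_recl big_ord1 /cofactor !det_mx11 !mxE /=.
by rewrite expr0 expr1 mul1r mulN1r mulrN.
Qed.

Context {R : realType}.
Implicit Types a b c d : R.

Lemma complexD a b c d : (a +i* b) + (c +i* d) = (a + c) +i* (b + d) :> R[i].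
Proof. by []. Qed.

Lemma complexN a b : - (a +i* b) = (- a) +i* (- b) :> R[i].
Proof. by []. Qed.

Lemma complexM a b c d : (a +i* b) * (c +i* d) = (a * c - b * d) +i* (a * d + b * c) :> R[i].
Proof. by []. Qed.

Lemma complex_inj a b c d : a +i* b = c +i* d -> a = c /\ b = d.
Proof. by case. Qed.

Lemma adjoint_mx2 (a b c d : R[i]) :
  adjoint (mx2 a b c d) = mx2 (conjc a) (conjc c) (conjc b) (conjc d).
Proof.
by apply/matrixP => i j; rewrite !mxE; case: (ord2P i) => ->; case: (ord2P j) => ->.
Qed.

(** The determinant being one on SU(1,0,1), the diagonal entries of an element
    of the group are conjugate to each other. *)
Lemma groupG_coord (M : 'M[R[i]]_2) : groupG M ->
  let a := M 0 0 in
  M = mx2 a (M 0 1) 0 (complex.Re a +i* (- complex.Im a)) /\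
  0 < complex.Re a * complex.Re a + complex.Im a * complex.Im a.
Proof.
move=> [r [A [r0 [t [w ->]] ->]]] /=; rewrite scale_mx2 !mxE /=; split.
  by rewrite !complexM cosN sinN !mul0r !mulr0 !subr0 !addr0 mulrN.
rewrite !mul0r !subr0 !addr0.
have -> : r * cos t * (r * cos t) + r * sin t * (r * sin t) = r ^+ 2 * (cos t ^+ 2 + sin t ^+ 2).
  by ring.
by rewrite cos2Dsin2 mulr1 exprn_gt0.
Qed.

End Matrix2.

Section Coordinates.
Context {R : realType} {Sigma : set (plane R)}.
Hypothesis Sigma_open : open Sigma.
Implicit Types (p w : plane R).

Lemma partial_mx2 (F : plane R -> 'M[R[i]]_2) (f1 g1 f2 g2 f3 g3 f4 g4 : plane R -> R) p w :
  (forall q, Sigma q -> F q = mx2 (f1 q +i* g1 q) (f2 q +i* g2 q) (f3 q +i* g3 q) (f4 q +i* g4 q)) ->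
  Sigma p ->
  partial w F p = mx2 ('D_w f1 p +i* 'D_w g1 p) ('D_w f2 p +i* 'D_w g2 p)
                      ('D_w f3 p +i* 'D_w g3 p) ('D_w f4 p +i* 'D_w g4 p).
Proof.
move=> FE Sp; apply/matrixP => i j; rewrite !mxE.
case: (ord2P i) => ->; case: (ord2P j) => -> /=; congr (_ +i* _);
  by apply: (derive_congr Sigma_open) => // q Sq; rewrite FE // !mxE.
Qed.

End Coordinates.

(** * The spin form in real coordinates *)

Lemma herm_mx2_eq0 (R : realType) (s0 t0 s1 t1 s2 t2 : R) :
  mx2 ((2 * (s0 - t0)) +i* 0) ((s1 - t1) +i* (s2 - t2)) ((s1 - t1) -i* (s2 - t2)) 0 = 0 <->
  [/\ s0 = t0, s1 = t1 & s2 = t2].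
Proof.
split=> [e|[-> -> ->]]; last by rewrite !subrr mulr0 oppr0 -zero_mx2.
have [h0 h1 _ _] := mx2_inj (etrans e (zero_mx2 _)).
by have [e0 _] := complex_inj h0; have [e1 e2] := complex_inj h1; split; lra.
Qed.

(** The two last hypotheses express (s1 - t1) + i (s2 - t2) as 2 a w, where the
    complex numbers a = (c, d) and w = (r, i) are such that a is not zero. *)
Lemma curl_eq0 (R : realType) (c d e f r i Q1 Q2 s0 t0 s1 t1 s2 t2 : R) :
  0 < c * c + d * d ->
  s0 - t0 = c * Q1 + d * Q2 + e * r + f * i ->
  s1 - t1 = 2 * (c * r - d * i) -> s2 - t2 = 2 * (c * i + d * r) ->
  [/\ s0 = t0, s1 = t1 & s2 = t2] <-> [/\ r = 0, i = 0 & c * Q1 + d * Q2 = 0].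
Proof.
move=> N0 c0 c1 c2; split=> [[e0 e1 e2]|[e0 e1 e2]]; last first.
  by split; apply: subr0_eq; rewrite ?c0 ?c1 ?c2 ?e2 e0 e1; ring.
rewrite e0 subrr in c0; rewrite e1 subrr in c1; rewrite e2 subrr in c2.
have Nn0 : c * c + d * d != 0 by rewrite gt_eqF.
have r0 : r = 0.
  apply: (mulIf Nn0); rewrite mul0r.
  have -> : r * (c * c + d * d) = (c * (2 * (c * r - d * i)) + d * (2 * (c * i + d * r))) / 2.
    by field.
  by rewrite -c1 -c2; ring.
have i0 : i = 0.
  apply: (mulIf Nn0); rewrite mul0r.
  have -> : i * (c * c + d * d) = (c * (2 * (c * i + d * r)) - d * (2 * (c * r - d * i))) / 2.
    by field.
  by rewrite -c1 -c2; ring.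
by split=> //; rewrite c0 r0 i0; ring.
Qed.

(** Throughout, a = a1 + i a2 and b = b1 + i b2 are the entries of the first row
    of B, h is half of the upper left entry of X and zeta = x1 + i x2 the upper
    right one. *)
Section SpinCoordinates.
Context {R : realType} {Sigma : set (plane R)}.
Hypothesis Sigma_open : open Sigma.
Variables (B : plane R -> 'M[R[i]]_2) (x : plane R -> 'cV[R]_4).
Variables (a1 a2 b1 b2 h x1 x2 : plane R -> R).
Hypothesis BE : forall q, Sigma q ->
  B q = mx2 (a1 q +i* a2 q) (b1 q +i* b2 q) 0 (a1 q -i* a2 q).
Hypothesis XE : forall q, Sigma q ->
  herm (x q) = mx2 (2 * h q)%:C (x1 q +i* x2 q) (x1 q -i* x2 q) 0.
Hypothesis norm_gt0 : forall q, Sigma q -> 0 < a1 q * a1 q + a2 q * a2 q.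
Hypotheses (a1s : smooth Sigma a1) (a2s : smooth Sigma a2).
Hypotheses (b1s : smooth Sigma b1) (b2s : smooth Sigma b2).
Hypotheses (hs : smooth Sigma h) (x1s : smooth Sigma x1) (x2s : smooth Sigma x2).
Implicit Types (p w : plane R).

Lemma partial_B p w : coordinate_direction w -> Sigma p ->
  partial w B p = mx2 ('D_w a1 p +i* 'D_w a2 p) ('D_w b1 p +i* 'D_w b2 p)
                      0 ('D_w a1 p -i* 'D_w a2 p).
Proof.
move=> wP Sp.
rewrite (@partial_mx2 _ _ Sigma_open B a1 a2 b1 b2 (fun=> 0) (fun=> 0) a1 (fun q => - a2 q)) //.
by rewrite !derive_cst deriveN //; exact: smooth_derivable a2s wP Sp.
Qed.

Lemma partial_X p w : coordinate_direction w -> Sigma p ->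
  partial w (fun q => herm (x q)) p =
  mx2 (2 * 'D_w h p)%:C ('D_w x1 p +i* 'D_w x2 p) ('D_w x1 p -i* 'D_w x2 p) 0.
Proof.
move=> wP Sp.
rewrite (@partial_mx2 _ _ Sigma_open _ (fun q => 2 * h q) (fun=> 0) x1 x2 x1
           (fun q => - x2 q) (fun=> 0) (fun=> 0)) //.
have [_ ->] := is_derive_cmul 2 (smooth_is_derive hs wP Sp).
by rewrite !derive_cst deriveN //; exact: smooth_derivable x2s wP Sp.
Qed.

(** B dX B^* has upper left entry 2 spin0 and upper right entry
    spin1 + i spin2 = a^2 dzeta, evaluated on the direction w. *)
Definition spin0 w q := (a1 q * a1 q + a2 q * a2 q) * 'D_w h q +
  ((a1 q * b1 q + a2 q * b2 q) * 'D_w x1 q + (a1 q * b2 q - a2 q * b1 q) * 'D_w x2 q).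
Definition spin1 w q := (a1 q * a1 q - a2 q * a2 q) * 'D_w x1 q - 2 * (a1 q * a2 q * 'D_w x2 q).
Definition spin2 w q := (a1 q * a1 q - a2 q * a2 q) * 'D_w x2 q + 2 * (a1 q * a2 q * 'D_w x1 q).

Lemma spin_formE p : Sigma p -> spin_form B x p =
  (mx2 (2 * spin0 e_u p)%:C (spin1 e_u p +i* spin2 e_u p) (spin1 e_u p -i* spin2 e_u p) 0,
   mx2 (2 * spin0 e_v p)%:C (spin1 e_v p +i* spin2 e_v p) (spin1 e_v p -i* spin2 e_v p) 0).
Proof.
have E w : coordinate_direction w -> Sigma p ->
    B p *m partial w (fun q => herm (x q)) p *m adjoint (B p) =
    mx2 (2 * spin0 w p)%:C (spin1 w p +i* spin2 w p) (spin1 w p -i* spin2 w p) 0.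
  move=> wP Sp; rewrite partial_X // BE // adjoint_mx2 !mul_mx2 /= /spin0 /spin1 /spin2.
  have zC : (0 : R[i]) = 0 +i* 0 by [].
  rewrite zC !(complexM, complexD).
  move: (a1 p) (a2 p) (b1 p) (b2 p) ('D_w h p) ('D_w x1 p) ('D_w x2 p) => *.
  by congr mx2; congr (_ +i* _); ring.
by move=> Sp; congr pair; [exact: (E _ dir_u Sp)|exact: (E _ dir_v Sp)].
Qed.

Lemma smooth_spin0 w : coordinate_direction w -> smooth Sigma (spin0 w).
Proof.
move=> wP; have hw := smooth_derive hs wP; have x1w := smooth_derive x1s wP.
have x2w := smooth_derive x2s wP.
by rewrite /spin0; do ?[apply: smoothB|apply: smoothD|apply: smoothM].
Qed.

Lemma smooth_spin1 w : coordinate_direction w -> smooth Sigma (spin1 w).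
Proof.
move=> wP; have x1w := smooth_derive x1s wP; have x2w := smooth_derive x2s wP.
by rewrite /spin1; do ?[apply: smoothB|apply: smoothD|apply: smoothM|exact: smooth_cst].
Qed.

Lemma smooth_spin2 w : coordinate_direction w -> smooth Sigma (spin2 w).
Proof.
move=> wP; have x1w := smooth_derive x1s wP; have x2w := smooth_derive x2s wP.
by rewrite /spin2; do ?[apply: smoothB|apply: smoothD|apply: smoothM|exact: smooth_cst].
Qed.

Section Derivatives.
Variables (w d p : plane R).
Hypotheses (wP : coordinate_direction w) (dP : coordinate_direction d) (Sp : Sigma p).

Let A1 := smooth_is_derive a1s dP Sp.
Let A2 := smooth_is_derive a2s dP Sp.
Let B1 := smooth_is_derive b1s dP Sp.
Let B2 := smooth_is_derive b2s dP Sp.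
Let H := smooth_is_derive (smooth_derive hs wP) dP Sp.
Let X1 := smooth_is_derive (smooth_derive x1s wP) dP Sp.
Let X2 := smooth_is_derive (smooth_derive x2s wP) dP Sp.

Lemma derive_spin0 : 'D_d (spin0 w) p =
  2 * (a1 p * 'D_d a1 p + a2 p * 'D_d a2 p) * 'D_w h p +
  (a1 p * a1 p + a2 p * a2 p) * 'D_d ('D_w h) p +
  ('D_d a1 p * b1 p + a1 p * 'D_d b1 p + 'D_d a2 p * b2 p + a2 p * 'D_d b2 p) * 'D_w x1 p +
  (a1 p * b1 p + a2 p * b2 p) * 'D_d ('D_w x1) p +
  ('D_d a1 p * b2 p + a1 p * 'D_d b2 p - 'D_d a2 p * b1 p - a2 p * 'D_d b1 p) * 'D_w x2 p +
  (a1 p * b2 p - a2 p * b1 p) * 'D_d ('D_w x2) p.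
Proof.
have [_ ->] := is_derive_add
  (is_derive_mul (is_derive_add (is_derive_mul A1 A1) (is_derive_mul A2 A2)) H)
  (is_derive_add
    (is_derive_mul (is_derive_add (is_derive_mul A1 B1) (is_derive_mul A2 B2)) X1)
    (is_derive_mul (is_derive_sub (is_derive_mul A1 B2) (is_derive_mul A2 B1)) X2)).
move: ('D_d a1 p) ('D_d a2 p) ('D_d b1 p) ('D_d b2 p) ('D_w h p) ('D_w x1 p) ('D_w x2 p).
move: ('D_d ('D_w h) p) ('D_d ('D_w x1) p) ('D_d ('D_w x2) p) => *; ring.
Qed.

Lemma derive_spin1 : 'D_d (spin1 w) p =
  2 * (a1 p * 'D_d a1 p - a2 p * 'D_d a2 p) * 'D_w x1 p +
  (a1 p * a1 p - a2 p * a2 p) * 'D_d ('D_w x1) p -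
  2 * ('D_d a1 p * a2 p + a1 p * 'D_d a2 p) * 'D_w x2 p -
  2 * (a1 p * a2 p) * 'D_d ('D_w x2) p.
Proof.
have [_ ->] := is_derive_sub
  (is_derive_mul (is_derive_sub (is_derive_mul A1 A1) (is_derive_mul A2 A2)) X1)
  (is_derive_cmul 2 (is_derive_mul (is_derive_mul A1 A2) X2)).
move: ('D_d a1 p) ('D_d a2 p) ('D_w x1 p) ('D_w x2 p).
move: ('D_d ('D_w x1) p) ('D_d ('D_w x2) p) => *; ring.
Qed.

Lemma derive_spin2 : 'D_d (spin2 w) p =
  2 * (a1 p * 'D_d a1 p - a2 p * 'D_d a2 p) * 'D_w x2 p +
  (a1 p * a1 p - a2 p * a2 p) * 'D_d ('D_w x2) p +
  2 * ('D_d a1 p * a2 p + a1 p * 'D_d a2 p) * 'D_w x1 p +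
  2 * (a1 p * a2 p) * 'D_d ('D_w x1) p.
Proof.
have [_ ->] := is_derive_add
  (is_derive_mul (is_derive_sub (is_derive_mul A1 A1) (is_derive_mul A2 A2)) X2)
  (is_derive_cmul 2 (is_derive_mul (is_derive_mul A1 A2) X1)).
move: ('D_d a1 p) ('D_d a2 p) ('D_w x1 p) ('D_w x2 p).
move: ('D_d ('D_w x1) p) ('D_d ('D_w x2) p) => *; ring.
Qed.

End Derivatives.

Definition spin_closed p := [/\ 'D_e_u (spin0 e_v) p = 'D_e_v (spin0 e_u) p,
  'D_e_u (spin1 e_v) p = 'D_e_v (spin1 e_u) p & 'D_e_u (spin2 e_v) p = 'D_e_v (spin2 e_u) p].

Lemma closed_formE : closed_form Sigma (spin_form B x) <-> forall p, Sigma p -> spin_closed p.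
Proof.
suff E p : Sigma p -> d1 (spin_form B x) p =
    mx2 ((2 * ('D_e_u (spin0 e_v) p - 'D_e_v (spin0 e_u) p)) +i* 0)
        (('D_e_u (spin1 e_v) p - 'D_e_v (spin1 e_u) p) +i*
         ('D_e_u (spin2 e_v) p - 'D_e_v (spin2 e_u) p))
        (('D_e_u (spin1 e_v) p - 'D_e_v (spin1 e_u) p) -i*
         ('D_e_u (spin2 e_v) p - 'D_e_v (spin2 e_u) p)) 0.
  split=> C p Sp; first by apply/herm_mx2_eq0; apply: etrans (C p Sp); exact/esym/E.
  by apply: (etrans (E p Sp)); apply/herm_mx2_eq0; exact: (C p Sp).
move=> Sp.
have D w d : coordinate_direction w -> coordinate_direction d ->
    partial d (fun q => mx2 (2 * spin0 w q)%:C (spin1 w q +i* spin2 w q)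
                            (spin1 w q -i* spin2 w q) 0) p =
    mx2 (2 * 'D_d (spin0 w) p)%:C ('D_d (spin1 w) p +i* 'D_d (spin2 w) p)
        ('D_d (spin1 w) p -i* 'D_d (spin2 w) p) 0.
  move=> wP dP.
  rewrite (@partial_mx2 _ _ Sigma_open _ (fun q => 2 * spin0 w q) (fun=> 0) (spin1 w) (spin2 w)
           (spin1 w) (fun q => - spin2 w q) (fun=> 0) (fun=> 0)) //.
  have [_ ->] := is_derive_cmul 2 (smooth_is_derive (smooth_spin0 wP) dP Sp).
  by rewrite !derive_cst deriveN; [|exact: smooth_derivable (smooth_spin2 wP) dP Sp].
have P d (F : plane R -> 'M[R[i]]_2) G : (forall q, Sigma q -> F q = G q) ->
    partial d F p = partial d G p.
  move=> FG; apply/matrixP => i j; rewrite !mxE.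
  by congr (_ +i* _); apply: (derive_congr Sigma_open); [move=> q Sq; rewrite (FG q Sq)|exact: Sp|
    move=> q Sq; rewrite (FG q Sq)|exact: Sp].
have Du := etrans (P e_u _ _ (fun q Sq => congr1 snd (spin_formE Sq))) (D _ _ dir_v dir_u).
have Dv := etrans (P e_v _ _ (fun q Sq => congr1 fst (spin_formE Sq))) (D _ _ dir_u dir_v).
rewrite /d1 Du Dv sub_mx2 subrr.
congr (mx2 _ _ _ _); congr (_ +i* _).
- by rewrite mulrBr.
- by rewrite subrr.
- by rewrite opprB opprK addrC.
Qed.

(** The coefficient of du /\ dv in df /\ dg. *)
Definition wdg (f g : plane R -> R) p := 'D_e_u f p * 'D_e_v g p - 'D_e_v f p * 'D_e_u g p.

(** The entries of dB /\ dX in the first row: da /\ dzeta on the right and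
    2 da /\ dh + db /\ conj(dzeta) on the left. *)
Definition dBdX01_re p := wdg a1 x1 p - wdg a2 x2 p.
Definition dBdX01_im p := wdg a1 x2 p + wdg a2 x1 p.
Definition dBdX00_re p := 2 * wdg a1 h p + wdg b1 x1 p + wdg b2 x2 p.
Definition dBdX00_im p := 2 * wdg a2 h p + wdg b2 x1 p - wdg b1 x2 p.

(** The second derivatives of h and zeta cancel by symmetry, and what remains of
    the exterior derivative of the spin form involves dB /\ dX alone. *)
Lemma curl_spin p : Sigma p ->
  [/\ 'D_e_u (spin0 e_v) p - 'D_e_v (spin0 e_u) p =
        a1 p * dBdX00_re p + a2 p * dBdX00_im p + b1 p * dBdX01_re p + b2 p * dBdX01_im p,
      'D_e_u (spin1 e_v) p - 'D_e_v (spin1 e_u) p =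
        2 * (a1 p * dBdX01_re p - a2 p * dBdX01_im p) &
      'D_e_u (spin2 e_v) p - 'D_e_v (spin2 e_u) p =
        2 * (a1 p * dBdX01_im p + a2 p * dBdX01_re p)].
Proof.
move=> Sp; have sub (s t s' t' : R) : s = s' -> t = t' -> s - t = s' - t' by move=> -> ->.
have hc := smooth_derive_comm Sigma_open hs Sp.
have x1c := smooth_derive_comm Sigma_open x1s Sp.
have x2c := smooth_derive_comm Sigma_open x2s Sp.
split.
- apply: etrans (sub _ _ _ _ (derive_spin0 dir_v dir_u Sp) (derive_spin0 dir_u dir_v Sp)) _.
  move: hc x1c x2c; clear; rewrite /dBdX00_re /dBdX00_im /dBdX01_re /dBdX01_im /wdg.
  move: ('D_e_v ('D_e_u h) p) ('D_e_v ('D_e_u x1) p) ('D_e_v ('D_e_u x2) p).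
  move: ('D_e_u ('D_e_v h) p) ('D_e_u ('D_e_v x1) p) ('D_e_u ('D_e_v x2) p).
  move: ('D_e_u a1 p) ('D_e_v a1 p) ('D_e_u a2 p) ('D_e_v a2 p).
  move: ('D_e_u b1 p) ('D_e_v b1 p) ('D_e_u b2 p) ('D_e_v b2 p).
  move: ('D_e_u h p) ('D_e_v h p) ('D_e_u x1 p) ('D_e_v x1 p) ('D_e_u x2 p) ('D_e_v x2 p).
  by do 20!move=> ?; move=> -> -> ->; ring.
- apply: etrans (sub _ _ _ _ (derive_spin1 dir_v dir_u Sp) (derive_spin1 dir_u dir_v Sp)) _.
  move: x1c x2c; clear; rewrite /dBdX01_re /dBdX01_im /wdg.
  move: ('D_e_v ('D_e_u x1) p) ('D_e_v ('D_e_u x2) p).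
  move: ('D_e_u ('D_e_v x1) p) ('D_e_u ('D_e_v x2) p).
  move: ('D_e_u a1 p) ('D_e_v a1 p) ('D_e_u a2 p) ('D_e_v a2 p).
  move: ('D_e_u x1 p) ('D_e_v x1 p) ('D_e_u x2 p) ('D_e_v x2 p).
  by do 12!move=> ?; move=> -> ->; ring.
- apply: etrans (sub _ _ _ _ (derive_spin2 dir_v dir_u Sp) (derive_spin2 dir_u dir_v Sp)) _.
  move: x1c x2c; clear; rewrite /dBdX01_re /dBdX01_im /wdg.
  move: ('D_e_v ('D_e_u x1) p) ('D_e_v ('D_e_u x2) p).
  move: ('D_e_u ('D_e_v x1) p) ('D_e_u ('D_e_v x2) p).
  move: ('D_e_u a1 p) ('D_e_v a1 p) ('D_e_u a2 p) ('D_e_v a2 p).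
  move: ('D_e_u x1 p) ('D_e_v x1 p) ('D_e_u x2 p) ('D_e_v x2 p).
  by do 12!move=> ?; move=> -> ->; ring.
Qed.

Lemma spin_closedE p : Sigma p -> spin_closed p <->
  [/\ dBdX01_re p = 0, dBdX01_im p = 0 & a1 p * dBdX00_re p + a2 p * dBdX00_im p = 0].
Proof.
by move=> Sp; have [c0 c1 c2] := curl_spin Sp; exact: curl_eq0 (norm_gt0 Sp) c0 c1 c2.
Qed.

(** After multiplication by B on the left, both sides have a zero lower right
    entry and conjugate off-diagonal entries, and dX /\ Ptilde dX is 2 i wdg x1 x2
    in the upper left corner and zero elsewhere. *)
Lemma spin_potentialE p (rho : R) : Sigma p ->
  let dX := d0 (fun q => herm (x q)) in
  wedge (mulf_form (fun q => invmx (B q)) (d0 B)) dX p =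
    - (rho%:C *: wedge dX (mulf_form (fun=> mx_Ptilde) dX) p) <->
  [/\ dBdX01_re p = 0, dBdX01_im p = 0,
      dBdX00_re p = 2 * rho * a2 p * wdg x1 x2 p & dBdX00_im p = - (2 * rho * a1 p * wdg x1 x2 p)].
Proof.
move=> Sp /=; rewrite /wedge /mulf_form /d0 /=.
have BU : B p \in unitmx.
  rewrite unitmxE BE // det_mx2 unitfE mulr0 subr0 complexM.
  apply/eqP => /complex_inj[e _]; have := norm_gt0 Sp.
  by rewrite mulrN opprK in e; rewrite e ltxx.
rewrite -!mulmxA -mulmxBr.
set L := _ - _; set M := - _.
have -> : invmx (B p) *m L = M <-> L = B p *m M.
  by split=> [<-|->]; rewrite mulmxA ?mulmxV ?mulVmx ?mul1mx.
rewrite /L /M (partial_B dir_u Sp) (partial_B dir_v Sp) (partial_X dir_u Sp) (partial_X dir_v Sp).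
rewrite (BE Sp) /mx_Ptilde /dBdX00_re /dBdX00_im /dBdX01_re /dBdX01_im /wdg.
move: ('D_e_u a1 p) ('D_e_v a1 p) ('D_e_u a2 p) ('D_e_v a2 p).
move: ('D_e_u b1 p) ('D_e_v b1 p) ('D_e_u b2 p) ('D_e_v b2 p).
move: ('D_e_u h p) ('D_e_v h p) ('D_e_u x1 p) ('D_e_v x1 p) ('D_e_u x2 p) ('D_e_v x2 p).
move: (a1 p) (a2 p) (b1 p) (b2 p); clear.
move=> c d e f hu hv yu yv zu zv eu ev fu fv cu cv du dv.
rewrite !mul_mx2 !sub_mx2 scale_mx2 opp_mx2 !mul_mx2.
have zC : (0 : R[i]) = 0 +i* 0 by [].
have oC : (-1 : R[i]) = (-1) +i* 0 by rewrite -[in RHS]oppr0.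
rewrite oC !zC !(complexM, complexD, complexN).
split=> [E|].
  have [h1 h2 _ _] := mx2_inj E; have [e1 e2] := complex_inj h1; have [e3 e4] := complex_inj h2.
  by clear E h1 h2; split; lra.
by move=> [e1 e2 e3 e4]; congr (mx2 _ _ _ _); congr (_ +i* _); lra.
Qed.

End SpinCoordinates.

(** * Conformal immersions in isotropic space *)

(** With u, v the first derivatives of a planar map and uu, uv, vv the second
    ones, the four last hypotheses are the derivatives of |u|^2 = |v|^2 and
    u . v = 0. They force the Laplacian uu + vv to be orthogonal to both u and v,
    which form a basis. *)
Lemma harmonic_alg (R : realType) (u1 u2 v1 v2 uu1 uv1 vv1 uu2 uv2 vv2 e : R) :
  0 < e -> u1 * u1 + u2 * u2 = e -> v1 * v1 + v2 * v2 = e -> u1 * v1 + u2 * v2 = 0 ->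
  u1 * uu1 + u2 * uu2 = v1 * uv1 + v2 * uv2 ->
  u1 * uv1 + u2 * uv2 = v1 * vv1 + v2 * vv2 ->
  uu1 * v1 + u1 * uv1 + uu2 * v2 + u2 * uv2 = 0 ->
  uv1 * v1 + u1 * vv1 + uv2 * v2 + u2 * vv2 = 0 ->
  uu1 + vv1 = 0 /\ uu2 + vv2 = 0.
Proof.
move=> e0 eu ev euv h1 h2 h3 h4.
have lu : u1 * (uu1 + vv1) + u2 * (uu2 + vv2) = 0 by lra.
have lv : v1 * (uu1 + vv1) + v2 * (uu2 + vv2) = 0 by lra.
move: lu lv; set l1 := uu1 + vv1; set l2 := uu2 + vv2 => lu lv; clear h1 h2 h3 h4.
have J2 : (u1 * v2 - u2 * v1) * (u1 * v2 - u2 * v1) = e * e.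
  have -> : (u1 * v2 - u2 * v1) * (u1 * v2 - u2 * v1) = (u1 * u1 + u2 * u2) * (v1 * v1 + v2 * v2)
    - (u1 * v1 + u2 * v2) * (u1 * v1 + u2 * v2) by ring.
  by rewrite eu ev euv mul0r subr0.
have J0 : u1 * v2 - u2 * v1 != 0.
  by apply: contraTneq e0 => J; move: J2; rewrite J mul0r => /esym/eqP; rewrite mulf_eq0 orbb => /eqP ->; rewrite ltxx.
split; apply: (mulIf J0); rewrite mul0r.
- by rewrite -[RHS](_ : v2 * (u1 * l1 + u2 * l2) - u2 * (v1 * l1 + v2 * l2) = 0);
    [ring|rewrite lu lv; ring].
- by rewrite -[RHS](_ : u1 * (v1 * l1 + v2 * l2) - v1 * (u1 * l1 + u2 * l2) = 0);
    [ring|rewrite lu lv; ring].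
Qed.

Lemma complex_half (R : realType) : (2^-1 : R[i]) = 2^-1 +i* 0.
Proof. by rewrite -[RHS]/((2^-1)%:C) fmorphV rmorph_nat. Qed.

Lemma wirtinger_laplacian (R : realType) (a b c d uu uv vu vv : R) :
  a = 2^-1 * uu -> b = - 2^-1 * uv -> c = 2^-1 * vu -> d = - 2^-1 * vv -> vu = uv ->
  2^-1 * ((a +i* b) + (0 +i* 1) * (c +i* d)) = (4^-1 * (uu + vv))%:C.
Proof.
move=> -> -> -> -> ->; rewrite complex_half !(complexM, complexD).
by congr (_ +i* _); field.
Qed.

Lemma mean_curvature_alg (R : realType) (E l g0 g1 g2 g3 : R) :
  - (g0 * 1) + g1 * 0 + g2 * 0 + g3 * 1 = 1 ->
  2 * E * (- (4^-1 * l * g0) + 4^-1 * 0 * g1 + 4^-1 * 0 * g2 + 4^-1 * l * g3) = 2^-1 * E * l.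
Proof. by move=> gp; have -> : g3 = 1 + g0 by [lra]; field. Qed.

Section ConformalImmersion.
Context {R : realType} {Sigma : set (plane R)}.
Hypothesis Sigma_open : open Sigma.
Variable x : plane R -> 'cV[R]_4.
Hypothesis xs : smooth Sigma x.
Hypothesis xI : forall p, Sigma p -> isotropic3 (x p).
Implicit Types (p w d : plane R).

Let x0 q := x q 0 0.
Let x1 q := x q 1 0.
Let x2 q := x q 2 0.

Lemma isotropicE p : Sigma p -> x p 3 0 = x p 0 0.
Proof.
move=> /xI; rewrite /isotropic3 /= /lorentz /vec_p !mxE /= !mulr1 !mulr0 !addr0 => e.
by apply/eqP; rewrite -subr_eq0 addrC e.
Qed.

Let x0s : smooth Sigma x0. Proof. exact: smooth_entry. Qed.
Let x1s : smooth Sigma x1. Proof. exact: smooth_entry. Qed.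
Let x2s : smooth Sigma x2. Proof. exact: smooth_entry. Qed.

Lemma derive_coord p w i : coordinate_direction w -> Sigma p ->
  ('D_w x p) i 0 = 'D_w (fun q => x q i 0) p.
Proof. by move=> wP Sp; apply: derive_entry; exact: smooth_derivable xs wP Sp. Qed.

Lemma derive_x3 p w : Sigma p -> 'D_w (fun q => x q 3 0) p = 'D_w x0 p.
Proof. by apply: (derive_congr Sigma_open) => q; exact: isotropicE. Qed.

Lemma lorentz_derive p w d : coordinate_direction w -> coordinate_direction d -> Sigma p ->
  lorentz ('D_w x p) ('D_d x p) = 'D_w x1 p * 'D_d x1 p + 'D_w x2 p * 'D_d x2 p.
Proof.
move=> wP dP Sp.
have L (y z : 'cV[R]_4) : y 3 0 = y 0 0 -> z 3 0 = z 0 0 ->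
    lorentz y z = y 1 0 * z 1 0 + y 2 0 * z 2 0.
  by rewrite /lorentz => -> ->; ring.
have iso e (eP : coordinate_direction e) : ('D_e x p) 3 0 = ('D_e x p) 0 0 :=
  etrans (derive_coord 3 eP Sp) (etrans (derive_x3 e Sp) (esym (derive_coord 0 eP Sp))).
apply: etrans (L _ _ (iso w wP) (iso d dP)) _.
by congr (_ * _ + _ * _); apply: derive_coord.
Qed.

Lemma conformal_atE p s : Sigma p -> conformal_at x p s <->
  [/\ 'D_e_u x1 p * 'D_e_u x1 p + 'D_e_u x2 p * 'D_e_u x2 p = expR (2 * s),
      'D_e_v x1 p * 'D_e_v x1 p + 'D_e_v x2 p * 'D_e_v x2 p = expR (2 * s) &
      'D_e_u x1 p * 'D_e_v x1 p + 'D_e_u x2 p * 'D_e_v x2 p = 0].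
Proof.
move=> Sp; have uu := lorentz_derive dir_u dir_u Sp; have vv := lorentz_derive dir_v dir_v Sp.
have uv := lorentz_derive dir_u dir_v Sp; split=> -[h1 h2 h3]; split.
- exact: etrans (esym uu) h1.
- exact: etrans (esym vv) h2.
- exact: etrans (esym uv) h3.
- exact: etrans uu h1.
- exact: etrans vv h2.
- exact: etrans uv h3.
Qed.

Section Conformal.
Variable sigma : plane R -> R.
Hypothesis xC : forall p, Sigma p -> conformal_at x p (sigma p).

Lemma log_factorE p : Sigma p -> log_factor x p = sigma p.
Proof.
move=> Sp; have := getPex (ex_intro _ _ (xC Sp)); rewrite -/(log_factor x p).
have [e _ _] := xC Sp; move=> [e' _ _].
have := etrans (esym e') e => /expR_inj /mulfI; apply.
by rewrite pnatr_eq0.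
Qed.

(** A conformal map is holomorphic or antiholomorphic; differentiating the
    conformality relations avoids choosing an orientation. *)
Lemma conformal_harmonic p : Sigma p ->
  'D_e_u ('D_e_u x1) p + 'D_e_v ('D_e_v x1) p = 0 /\
  'D_e_u ('D_e_u x2) p + 'D_e_v ('D_e_v x2) p = 0.
Proof.
move=> Sp.
have C q : Sigma q -> _ := fun Sq => (conformal_atE (sigma q) Sq).1 (xC Sq).
have c1 := smooth_derive_comm Sigma_open x1s Sp; have c2 := smooth_derive_comm Sigma_open x2s Sp.
have U1 d (dP : coordinate_direction d) := smooth_is_derive (smooth_derive x1s dir_u) dP Sp.
have U2 d (dP : coordinate_direction d) := smooth_is_derive (smooth_derive x2s dir_u) dP Sp.
have V1 d (dP : coordinate_direction d) := smooth_is_derive (smooth_derive x1s dir_v) dP Sp.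
have V2 d (dP : coordinate_direction d) := smooth_is_derive (smooth_derive x2s dir_v) dP Sp.
have norms d : coordinate_direction d ->
    'D_e_u x1 p * 'D_d ('D_e_u x1) p + 'D_e_u x2 p * 'D_d ('D_e_u x2) p =
    'D_e_v x1 p * 'D_d ('D_e_v x1) p + 'D_e_v x2 p * 'D_d ('D_e_v x2) p.
  move=> dP.
  have [_ eu] := is_derive_add (is_derive_mul (U1 d dP) (U1 d dP)) (is_derive_mul (U2 d dP) (U2 d dP)).
  have [_ ev] := is_derive_add (is_derive_mul (V1 d dP) (V1 d dP)) (is_derive_mul (V2 d dP) (V2 d dP)).
  have e := derive_congr Sigma_open (f := fun q => 'D_e_u x1 q * 'D_e_u x1 q + 'D_e_u x2 q * 'D_e_u x2 q)
    (g := fun q => 'D_e_v x1 q * 'D_e_v x1 q + 'D_e_v x2 q * 'D_e_v x2 q) d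
    (fun q Sq => let: And3 a b _ := C q Sq in etrans a (esym b)) Sp.
  move: (etrans (esym eu) (etrans e ev)); clear.
  move: ('D_e_u x1 p) ('D_e_u x2 p) ('D_e_v x1 p) ('D_e_v x2 p).
  move: ('D_d ('D_e_u x1) p) ('D_d ('D_e_u x2) p) ('D_d ('D_e_v x1) p) ('D_d ('D_e_v x2) p).
  by move=> *; lra.
have dots d : coordinate_direction d ->
    'D_d ('D_e_u x1) p * 'D_e_v x1 p + 'D_e_u x1 p * 'D_d ('D_e_v x1) p +
    'D_d ('D_e_u x2) p * 'D_e_v x2 p + 'D_e_u x2 p * 'D_d ('D_e_v x2) p = 0.
  move=> dP.
  have [_ eu] := is_derive_add (is_derive_mul (U1 d dP) (V1 d dP)) (is_derive_mul (U2 d dP) (V2 d dP)).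
  have e := derive_congr Sigma_open (f := fun q => 'D_e_u x1 q * 'D_e_v x1 q + 'D_e_u x2 q * 'D_e_v x2 q)
    (g := fun q => 0) d (fun q Sq => let: And3 _ _ a := C q Sq in a) Sp.
  by move: (etrans (esym eu) (etrans e (derive_cst _ _ _))); rewrite addrA.
have [eu ev euv] := C p Sp.
have nu := norms _ dir_u; have nv := norms _ dir_v.
have du := dots _ dir_u; have dv := dots _ dir_v.
rewrite -c1 -c2 in nu du.
exact: harmonic_alg (expR_gt0 _) eu ev euv nu nv du dv.
Qed.

(** The components y1, y2 are found by projecting on the orthogonal basis x_u, x_v
    of the plane; then y3 - y0 = 1 and y3 + y0 = - (y1^2 + y2^2) make y isotropic. *)
Lemma lightlike_normal_exists p : Sigma p -> lightlike_normal x p !=set0.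
Proof.
move=> Sp; have [eu ev euv] := (conformal_atE (sigma p) Sp).1 (xC Sp).
have E0 := expR_gt0 (2 * sigma p).
set e := expR _ in eu ev E0.
pose y1 := - ('D_e_u x0 p * 'D_e_u x1 p + 'D_e_v x0 p * 'D_e_v x1 p) / e.
pose y2 := - ('D_e_u x0 p * 'D_e_u x2 p + 'D_e_v x0 p * 'D_e_v x2 p) / e.
pose k := y1 * y1 + y2 * y2.
pose y : 'cV[R]_4 := \col_i (if i == 0 then - (1 + k) / 2 else if i == 1 then y1
                             else if i == 2 then y2 else (1 - k) / 2).
have L w : coordinate_direction w ->
    lorentz ('D_w x p) y = 'D_w x0 p + 'D_w x1 p * y1 + 'D_w x2 p * y2.
  move=> wP; have lin (z : 'cV[R]_4) : z 3 0 = z 0 0 -> lorentz z y = z 0 0 + z 1 0 * y1 + z 2 0 * y2.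
    by rewrite /lorentz !mxE /= => ->; field.
  apply: etrans (lin _ _) _.
    exact: etrans (derive_coord 3 wP Sp) (etrans (derive_x3 w Sp) (esym (derive_coord 0 wP Sp))).
  by congr (_ + _ * _ + _ * _); apply: derive_coord.
exists y; split.
- by rewrite /lorentz !mxE /= /k; field.
- by rewrite /lorentz /vec_p !mxE /=; field.
- apply: etrans (L _ dir_u) _; move: eu ev euv E0; rewrite /y1 /y2; clear.
  move: ('D_e_u x0 p) ('D_e_v x0 p) ('D_e_u x1 p) ('D_e_v x1 p) ('D_e_u x2 p) ('D_e_v x2 p).
  move=> c0 d0 c1 d1 c2 d2 eu ev euv E0.
  have en : e != 0 by rewrite gt_eqF.
  transitivity (c0 - (c0 * (c1 * c1 + c2 * c2) + d0 * (c1 * d1 + c2 * d2)) / e); first by field.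
  by rewrite eu euv; field.
- apply: etrans (L _ dir_v) _; move: eu ev euv E0; rewrite /y1 /y2; clear.
  move: ('D_e_u x0 p) ('D_e_v x0 p) ('D_e_u x1 p) ('D_e_v x1 p) ('D_e_u x2 p) ('D_e_v x2 p).
  move=> c0 d0 c1 d1 c2 d2 eu ev euv E0.
  have en : e != 0 by rewrite gt_eqF.
  transitivity (d0 - (d0 * (d1 * d1 + d2 * d2) + c0 * (c1 * d1 + c2 * d2)) / e); first by field.
  by rewrite ev euv; field.
Qed.

Definition laplacian (f : plane R -> R) p := 'D_e_u ('D_e_u f) p + 'D_e_v ('D_e_v f) p.

Lemma partial_zbar_z p : Sigma p ->
  partial_zbar (partial_z (fun q => complexify (x q))) p =
  complexify (\col_i (4^-1 * laplacian (fun q => x q i 0) p)).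
Proof.
move=> Sp; apply/matrixP => i j; rewrite (ord1 j) {j}.
pose xi q := x q i 0; have xis : smooth Sigma xi by exact: smooth_entry.
have zE q : partial_z (fun q => complexify (x q)) q i 0 =
    (2^-1 * 'D_e_u xi q) +i* (- (2^-1 * 'D_e_v xi q)).
  have re : (fun q => complex.Re (complexify (x q) i 0)) = xi by apply/funext => r; rewrite mxE.
  have im : (fun q => complex.Im (complexify (x q) i 0)) = cst 0 by apply/funext => r; rewrite mxE.
  rewrite !mxE re im !derive_cst complex_half !(complexM, complexN, complexD).
  by move: ('D_e_u xi q) ('D_e_v xi q) => c d; congr (_ +i* _); ring.
have re : (fun q => complex.Re (partial_z (fun q => complexify (x q)) q i 0)) =
    (fun q => 2^-1 * 'D_e_u xi q) by apply/funext => q; rewrite zE.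
have im : (fun q => complex.Im (partial_z (fun q => complexify (x q)) q i 0)) =
    (fun q => (- 2^-1) * 'D_e_v xi q) by apply/funext => q; rewrite zE /= mulNr.
rewrite [LHS]mxE [X in _ * X]mxE [X in _ * (X + _)]mxE [X in _ * (_ + X)]mxE [X in _ * (_ + _ * X)]mxE.
rewrite re im [RHS]mxE [X in _ = real_complex _ X]mxE -/xi /laplacian.
have D c w d (wP : coordinate_direction w) (dP : coordinate_direction d) :
    'D_d (fun q => c * 'D_w xi q) p = c * 'D_d ('D_w xi) p.
  by have [_ ->] := is_derive_cmul c (smooth_is_derive (smooth_derive xis wP) dP Sp).
exact: wirtinger_laplacian (D _ _ _ dir_u dir_u) (D _ _ _ dir_v dir_u) (D _ _ _ dir_u dir_v)
  (D _ _ _ dir_v dir_v) (smooth_derive_comm Sigma_open xis Sp).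
Qed.

Lemma lorentz_complexify (y z : 'cV[R]_4) : lorentz (complexify y) (complexify z) = (lorentz y z)%:C.
Proof. by rewrite /lorentz !mxE !rmorphD rmorphN !rmorphM. Qed.

(** The Laplacian of x is a multiple of the vector p, as x1 and x2 are harmonic,
    and the Gauss map has product 1 with p. *)
Lemma mean_curvatureE p : Sigma p ->
  mean_curvature x p = (2^-1 * expR (- 2 * sigma p) * laplacian x0 p)%:C.
Proof.
move=> Sp; rewrite /mean_curvature log_factorE // partial_zbar_z // lorentz_complexify.
have [_ gp _ _] : lightlike_normal x p (gauss_map x p).
  exact: getPex (lightlike_normal_exists Sp).
have [h1 h2] := conformal_harmonic Sp.
have lap3 : laplacian (fun q => x q 3 0) p = laplacian x0 p.
  have D3 w d := derive_congr Sigma_open d (fun q Sq => derive_x3 w Sq) Sp.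
  exact: (congr2 (fun c d : R => c + d) (D3 e_u e_u) (D3 e_v e_v)).
rewrite /lorentz !mxE lap3.
rewrite -/x0 -/x1 -/x2 [laplacian x1 p]h1 [laplacian x2 p]h2.
move: gp; rewrite /lorentz /vec_p !mxE /= => gp.
have two : (2 : R[i]) = 2%:C by rewrite rmorph_nat.
rewrite two -!rmorphM; congr (_%:C).
exact: mean_curvature_alg.
Qed.

End Conformal.
End ConformalImmersion.

(** * Real algebra of the transformation *)

Section Algebra.
Context {R : realType}.

(** Two orthogonal vectors of the same length in the plane differ by a quarter
    turn, in the direction given by the sign s of the orientation. *)
Lemma conformal_rotation (yu zu yv zv E : R) : 0 < E ->
  yu * yu + zu * zu = E -> yv * yv + zv * zv = E -> yu * yv + zu * zv = 0 ->
  exists s, [/\ s = 1 \/ s = -1, yv = - s * zu, zv = s * yu & yu * zv - yv * zu = s * E].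
Proof.
move=> E0 eu ev euv; have En : E != 0 by rewrite gt_eqF.
pose J := yu * zv - yv * zu; exists (J / E); split.
- suff : (J / E) ^+ 2 = 1.
    by move/eqP; rewrite sqrf_eq1 => /orP[/eqP ->|/eqP ->]; [left|right].
  have -> : (J / E) ^+ 2 = J * J / (E * E) by field.
  have -> : J * J = (yu * yu + zu * zu) * (yv * yv + zv * zv) - (yu * yv + zu * zv) ^+ 2.
    by rewrite /J; ring.
  by rewrite eu ev euv expr0n subr0 divff // mulf_neq0.
- apply: (mulfI En).
  transitivity (- (J * zu)); last by field.
  transitivity (- (J * zu) + (yu * (yu * yv + zu * zv))); last by rewrite euv mulr0 addr0.
  by rewrite -eu /J; ring.
- apply: (mulfI En).
  transitivity (J * yu); last by field.
  transitivity (J * yu + (zu * (yu * yv + zu * zv))); last by rewrite euv mulr0 addr0.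
  by rewrite -eu /J; ring.
- by rewrite -/J; field.
Qed.

Lemma jacobian_neq0 (yu zu yv zv E : R) : 0 < E ->
  yu * yu + zu * zu = E -> yv * yv + zv * zv = E -> yu * yv + zu * zv = 0 ->
  yu * zv - yv * zu != 0.
Proof.
move=> E0 eu ev euv; have [s [s1 _ _ ->]] := conformal_rotation E0 eu ev euv.
apply: mulf_neq0; last by rewrite gt_eqF.
by case: s1 => ->; rewrite ?oppr_eq0 oner_eq0.
Qed.

(** The left-hand side is the Laplacian of h', by the product rule. The equations
    da /\ dzeta = 0 turn into the Cauchy-Riemann equations of a with the same
    orientation sign s as for zeta; then the terms of first order combine into
    - s Im (conj(a) q), where q is the quantity fixed by the equations of rho. *)
Lemma spin_laplacian_alg (c d e f cu cv du dv eu ev fu fv hu hv huu hvv : R)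
    (yu yv yuu yvv zu zv zuu zvv E rho : R) :
  0 < E -> yu * yu + zu * zu = E -> yv * yv + zv * zv = E -> yu * yv + zu * zv = 0 ->
  yuu + yvv = 0 -> zuu + zvv = 0 ->
  (cu * yv - cv * yu) - (du * zv - dv * zu) = 0 ->
  (cu * zv - cv * zu) + (du * yv - dv * yu) = 0 ->
  2 * (cu * hv - cv * hu) + (eu * yv - ev * yu) + (fu * zv - fv * zu) =
    2 * rho * d * (yu * zv - yv * zu) ->
  2 * (du * hv - dv * hu) + (fu * yv - fv * yu) - (eu * zv - ev * zu) =
    - (2 * rho * c * (yu * zv - yv * zu)) ->
  (2 * (c * cu + d * du) * hu + (c * c + d * d) * huu +
   (cu * e + c * eu + du * f + d * fu) * yu + (c * e + d * f) * yuu +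
   (cu * f + c * fu - du * e - d * eu) * zu + (c * f - d * e) * zuu) +
  (2 * (c * cv + d * dv) * hv + (c * c + d * d) * hvv +
   (cv * e + c * ev + dv * f + d * fv) * yv + (c * e + d * f) * yvv +
   (cv * f + c * fv - dv * e - d * ev) * zv + (c * f - d * e) * zvv) =
  (c * c + d * d) * (huu + hvv) + 2 * rho * (c * c + d * d) * E.
Proof.
move=> E0 Eu Ev Euv ly lz w1 w2 q1 q2.
have [s [s1 yvE zvE JE]] := conformal_rotation E0 Eu Ev Euv.
have -> : yvv = - yuu by lra.
have -> : zvv = - zuu by lra.
rewrite JE in q1 q2; clear JE Ev Euv ly lz.
have En : E != 0 by rewrite gt_eqF.
have cvE : cv = - s * du.
  apply: (mulIf En); apply: subr0_eq.
  transitivity (- (yu * ((cu * yv - cv * yu) - (du * zv - dv * zu)) +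
                   zu * ((cu * zv - cv * zu) + (du * yv - dv * yu)))).
    by rewrite yvE zvE -Eu; ring.
  by rewrite w1 w2; ring.
have dvE : dv = s * cu.
  apply: (mulIf En); apply: subr0_eq.
  transitivity (zu * ((cu * yv - cv * yu) - (du * zv - dv * zu)) -
                yu * ((cu * zv - cv * zu) + (du * yv - dv * yu))).
    by rewrite yvE zvE -Eu; ring.
  by rewrite w1 w2; ring.
rewrite {}yvE {}zvE {}cvE {}dvE {w1 w2} in q1 q2 *.
have {q1 q2} q : - s * (c * (2 * (du * hv - s * cu * hu) +
     (fu * (- s * zu) - fv * yu) - (eu * (s * yu) - ev * zu)) -
   d * (2 * (cu * hv - - s * du * hu) +
     (eu * (- s * zu) - ev * yu) + (fu * (s * yu) - fv * zu))) =
   2 * rho * (c * c + d * d) * E.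
  rewrite q1 q2; transitivity (s * s * (2 * rho * (c * c + d * d) * E)); first by ring.
  by case: s1 => ->; ring.
by rewrite -q; case: s1 => ->; ring.
Qed.

(** In complex terms: if conj(a) q is purely imaginary, then q = - 2 i rho a J for
    the real number rho = - Im (conj(a) q) / (2 |a|^2 J). *)
Lemma potential_alg (c d Q1 Q2 J : R) : 0 < c * c + d * d -> J != 0 ->
  c * Q1 + d * Q2 = 0 ->
  let rho := (d * Q1 - c * Q2) * (2 * ((c * c + d * d) * J))^-1 in
  Q1 = 2 * rho * d * J /\ Q2 = - (2 * rho * c * J).
Proof.
move=> N0 J0 q; have Nn : c * c + d * d != 0 by rewrite gt_eqF.
split; rewrite /=.
- transitivity (Q1 - c * (c * Q1 + d * Q2) / (c * c + d * d)).
    by rewrite q mulr0 mul0r subr0.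
  by field; rewrite Nn J0.
- transitivity (Q2 - d * (c * Q1 + d * Q2) / (c * c + d * d)).
    by rewrite q mulr0 mul0r subr0.
  by field; rewrite Nn J0.
Qed.

(** Multiplication by a^2 is a similarity of ratio |a|^2. *)
Lemma spin_norm (c d yw zw yt zt : R) :
  ((c * c - d * d) * yw - 2 * (c * d * zw)) * ((c * c - d * d) * yt - 2 * (c * d * zt)) +
  ((c * c - d * d) * zw + 2 * (c * d * yw)) * ((c * c - d * d) * zt + 2 * (c * d * yt)) =
  (c * c + d * d) * (c * c + d * d) * (yw * yt + zw * zt).
Proof. by ring. Qed.

Lemma orthogonal_free (a b yu zu yv zv E : R) : 0 < E ->
  yu * yu + zu * zu = E -> yv * yv + zv * zv = E -> yu * yv + zu * zv = 0 ->
  a * yu + b * yv = 0 -> a * zu + b * zv = 0 -> a = 0 /\ b = 0.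
Proof.
move=> E0 eu ev euv h1 h2; have En : E != 0 by rewrite gt_eqF.
split; apply: (mulIf En); rewrite mul0r.
- transitivity (yu * (a * yu + b * yv) + zu * (a * zu + b * zv) - b * (yu * yv + zu * zv)).
    by rewrite -eu; ring.
  by rewrite h1 h2 euv; ring.
- transitivity (yv * (a * yu + b * yv) + zv * (a * zu + b * zv) - a * (yu * yv + zu * zv)).
    by rewrite -ev; ring.
  by rewrite h1 h2 euv; ring.
Qed.

End Algebra.

(** * Spin transformations *)

Lemma herm_mx2_inj (R : realType) (s0 s1 s2 t0 t1 t2 : R) :
  mx2 (2 * s0)%:C (s1 +i* s2) (s1 -i* s2) 0 = mx2 (2 * t0)%:C (t1 +i* t2) (t1 -i* t2) 0 ->
  [/\ s0 = t0, s1 = t1 & s2 = t2].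
Proof.
move=> e; have [h0 h1 _ _] := mx2_inj e.
by have [e0 _] := complex_inj h0; have [e1 e2] := complex_inj h1; split=> //; lra.
Qed.

Lemma herm_isotropic (R : realType) (y : 'cV[R]_4) : y 3 0 = y 0 0 ->
  herm y = mx2 (2 * y 0 0)%:C (y 1 0 +i* y 2 0) (y 1 0 -i* y 2 0) 0.
Proof. by move=> e; rewrite /herm e subrr mulr2n mulrDl mul1r. Qed.

Lemma combination_entry (R : realType) (y z : 'cV[R]_4) (a b : R) : a *: y + b *: z = 0 ->
  forall i, a * y i 0 + b * z i 0 = 0.
Proof. by move=> /matrixP e i; have := e i 0; rewrite !mxE. Qed.

Lemma mean_curvature_scale (R : realType) (E N l rho : R) : 0 < E -> 0 < N ->
  2^-1 * (N * N * E)^-1 * (N * l + 2 * rho * N * E) = (2^-1 * E^-1 * l + rho) / N.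
Proof.
move=> E0 N0; have En : E != 0 by rewrite gt_eqF.
have Nn : N != 0 by rewrite gt_eqF.
by field; rewrite En Nn.
Qed.

Lemma isotropic3_eq (R : realType) (y : 'cV[R]_4) : y 3 0 = y 0 0 -> isotropic3 y.
Proof. by rewrite /isotropic3 /= /lorentz /vec_p !mxE /= => ->; ring. Qed.

Section SpinTransformation.
Context {R : realType} {Sigma : set (plane R)}.
Hypothesis Sigma_sc : simply_connected_domain Sigma.
Variables (x : plane R -> 'cV[R]_4) (B : plane R -> 'M[R[i]]_2) (sigma : plane R -> R).
Hypothesis xs : smooth Sigma x.
Hypothesis xI : forall p, Sigma p -> isotropic3 (x p).
Hypothesis sigmas : smooth Sigma sigma.
Hypothesis xC : forall p, Sigma p -> conformal_at x p (sigma p).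
Hypothesis Bs : smooth_mx Sigma B.
Hypothesis BG : forall p, Sigma p -> groupG (B p).
Implicit Types (p w : plane R).

Let Sigma_open : open Sigma. Proof. by case: Sigma_sc. Qed.
Let a1 q := complex.Re (B q 0 0).
Let a2 q := complex.Im (B q 0 0).
Let b1 q := complex.Re (B q 0 1).
Let b2 q := complex.Im (B q 0 1).
Let x0 q := x q 0 0.
Let x1 q := x q 1 0.
Let x2 q := x q 2 0.
Let a1s : smooth Sigma a1. Proof. by have [] := Bs 0 0. Qed.
Let a2s : smooth Sigma a2. Proof. by have [] := Bs 0 0. Qed.
Let b1s : smooth Sigma b1. Proof. by have [] := Bs 0 1. Qed.
Let b2s : smooth Sigma b2. Proof. by have [] := Bs 0 1. Qed.
Let x0s : smooth Sigma x0. Proof. exact: smooth_entry. Qed.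
Let x1s : smooth Sigma x1. Proof. exact: smooth_entry. Qed.
Let x2s : smooth Sigma x2. Proof. exact: smooth_entry. Qed.

Let N q := a1 q * a1 q + a2 q * a2 q.

Let N_gt0 q : Sigma q -> 0 < N q.
Proof. by move=> /BG/groupG_coord[]. Qed.

Let BE q : Sigma q -> B q = mx2 (a1 q +i* a2 q) (b1 q +i* b2 q) 0 (a1 q -i* a2 q).
Proof.
by move=> /BG/groupG_coord[+ _]; rewrite /a1 /a2 /b1 /b2; case: (B q 0 0) => ? ?; case: (B q 0 1).
Qed.

Let XE (x' : plane R -> 'cV[R]_4) : (forall p, Sigma p -> isotropic3 (x' p)) -> forall q, Sigma q ->
  herm (x' q) = mx2 (2 * x' q 0 0)%:C (x' q 1 0 +i* x' q 2 0) (x' q 1 0 -i* x' q 2 0) 0.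
Proof. by move=> x'I q Sq; apply: herm_isotropic; exact: isotropicE x'I _ Sq. Qed.

Let S0 := spin0 a1 a2 b1 b2 x0 x1 x2.
Let S1 := spin1 a1 a2 x1 x2.
Let S2 := spin2 a1 a2 x1 x2.

Let metric p : Sigma p -> _ := fun Sp => (conformal_atE Sigma_open xs xI (sigma p) Sp).1 (xC Sp).

Lemma det_group p : Sigma p -> \det (B p) = (N p)%:C.
Proof.
move=> Sp; rewrite BE // det_mx2 mulr0 subr0 complexM /N.
by congr (_ +i* _); ring.
Qed.

Lemma jacobian_ne0 p : Sigma p -> wdg x1 x2 p != 0.
Proof.
move=> Sp; have [eu ev euv] := metric Sp.
exact: jacobian_neq0 (expR_gt0 _) eu ev euv.
Qed.

Definition spin_partials (x' : plane R -> 'cV[R]_4) := forall w p, coordinate_direction w -> Sigma p ->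
  [/\ 'D_w (fun q => x' q 0 0) p = S0 w p, 'D_w (fun q => x' q 1 0) p = S1 w p &
      'D_w (fun q => x' q 2 0) p = S2 w p].

Lemma spin_transformationE (x' : plane R -> 'cV[R]_4) : spin_transformation Sigma B x x' <->
  [/\ smooth Sigma x', forall p, Sigma p -> isotropic3 (x' p) & spin_partials x'].
Proof.
suff E : smooth Sigma x' -> (forall p, Sigma p -> isotropic3 (x' p)) ->
    (forall p, Sigma p -> d0 (fun q => herm (x' q)) p = spin_form B x p) <-> spin_partials x'.
  by split=> -[x's x'I] h; split=> //; exact/(E x's x'I).
move=> x's x'I.
have dX p w (wP : coordinate_direction w) (Sp : Sigma p) := partial_X Sigma_open (XE x'I)
  (smooth_entry Sigma_open 0 0 x's) (smooth_entry Sigma_open 2 0 x's) wP Sp.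
have sf p (Sp : Sigma p) := spin_formE Sigma_open BE (XE xI) x0s x2s Sp.
split=> [D w p wP Sp|D p Sp].
  have := etrans (D p Sp) (sf p Sp); rewrite /d0 => e.
  case: wP => ->; apply: herm_mx2_inj.
    exact: etrans (esym (dX p _ dir_u Sp)) (congr1 fst e).
  exact: etrans (esym (dX p _ dir_v Sp)) (congr1 snd e).
have [u0 u1 u2] := D _ _ dir_u Sp; have [v0 v1 v2] := D _ _ dir_v Sp.
apply: etrans (esym (sf p Sp)); congr pair.
  by apply: etrans (dX p _ dir_u Sp) _; rewrite u0 u1 u2.
by apply: etrans (dX p _ dir_v Sp) _; rewrite v0 v1 v2.
Qed.

Let closedE := closed_formE Sigma_open BE (XE xI) a1s a2s b1s b2s x0s x1s x2s.

Lemma spin_transformation_closed (x' : plane R -> 'cV[R]_4) : spin_transformation Sigma B x x' ->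
  closed_form Sigma (spin_form B x).
Proof.
move=> /spin_transformationE[x's x'I D]; apply/closedE => p Sp.
have E i (S : plane R -> plane R -> R) : (forall w, coordinate_direction w ->
    forall q, Sigma q -> 'D_w (fun q => x' q i 0) q = S w q) ->
    'D_e_u (S e_v) p = 'D_e_v (S e_u) p.
  move=> DS; have c := smooth_derive_comm Sigma_open (smooth_entry Sigma_open i 0 x's) Sp.
  have u := derive_congr Sigma_open e_v (DS _ dir_u) Sp.
  have v := derive_congr Sigma_open e_u (DS _ dir_v) Sp.
  exact: etrans (esym v) (etrans (esym c) u).
split.
- by apply: (E 0 S0) => w wP q Sq; have [] := D w q wP Sq.
- by apply: (E 1 S1) => w wP q Sq; have [] := D w q wP Sq.
- by apply: (E 2 S2) => w wP q Sq; have [] := D w q wP Sq.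
Qed.

Lemma closed_spin_transformation : closed_form Sigma (spin_form B x) ->
  exists x', spin_transformation Sigma B x x'.
Proof.
move=> /closedE C.
have s0 w (wP : coordinate_direction w) := smooth_spin0 Sigma_open a1s a2s b1s b2s x0s x1s x2s wP.
have s1 w (wP : coordinate_direction w) := smooth_spin1 Sigma_open a1s a2s x1s x2s wP.
have s2 w (wP : coordinate_direction w) := smooth_spin2 Sigma_open a1s a2s x1s x2s wP.
have [p Sp|F0 [F0s F0P]] := poincare Sigma_open Sigma_sc (s0 _ dir_u) (s0 _ dir_v).
  by have [e _ _] := C p Sp; exact: esym e.
have [p Sp|F1 [F1s F1P]] := poincare Sigma_open Sigma_sc (s1 _ dir_u) (s1 _ dir_v).
  by have [_ e _] := C p Sp; exact: esym e.
have [p Sp|F2 [F2s F2P]] := poincare Sigma_open Sigma_sc (s2 _ dir_u) (s2 _ dir_v).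
  by have [_ _ e] := C p Sp; exact: esym e.
pose x' q : 'cV[R]_4 :=
  \col_i (if i == 1 then F1 q else if i == 2 then F2 q else F0 q).
have E0 : (fun q => x' q 0 0) = F0 by apply/funext => q; rewrite mxE.
have E1 : (fun q => x' q 1 0) = F1 by apply/funext => q; rewrite mxE.
have E2 : (fun q => x' q 2 0) = F2 by apply/funext => q; rewrite mxE.
exists x'; apply/spin_transformationE; split.
- apply: (smooth_of_entries Sigma_open) => i j.
  have -> : (fun q => x' q i j) = if i == 1 then F1 else if i == 2 then F2 else F0.
    by apply/funext => q; rewrite mxE; case: ifP => // _; case: ifP.
  by case: ifP => _ //; case: ifP.
- by move=> p Sp; apply: isotropic3_eq; rewrite !mxE.
- move=> w p wP Sp; rewrite E0 E1 E2.
  have [_ _ u0 v0] := F0P p Sp; have [_ _ u1 v1] := F1P p Sp; have [_ _ u2 v2] := F2P p Sp.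
  by case: wP => ->; split; [exact: u0|exact: u1|exact: u2|exact: v0|exact: v1|exact: v2].
Qed.

Let potentialE := spin_potentialE Sigma_open BE (XE xI) N_gt0 a2s x0s x2s.
Let spin_closedE' := spin_closedE Sigma_open N_gt0 a1s a2s b1s b2s x0s x1s x2s.

Lemma spin_potential_closed rho : spin_potential Sigma B x rho ->
  closed_form Sigma (spin_form B x).
Proof.
move=> [_ P]; apply/closedE => p Sp; apply/(spin_closedE' Sp).
have [e1 e2 -> ->] := (potentialE (rho p) Sp).1 (P p Sp).
by split; [exact: e1|exact: e2|ring].
Qed.

Lemma closed_spin_potential : closed_form Sigma (spin_form B x) ->
  exists rho, spin_potential Sigma B x rho.
Proof.
move=> /closedE C.
exists (fun p => (a2 p * dBdX00_re a1 b1 b2 x0 x1 x2 p - a1 p * dBdX00_im a2 b1 b2 x0 x1 x2 p) *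
  (2 * (N p * wdg x1 x2 p))^-1); split.
  have W f g : smooth Sigma f -> smooth Sigma g -> smooth Sigma (wdg f g).
    move=> fs gs; have fu := smooth_derive fs dir_u; have fv := smooth_derive fs dir_v.
    have gu := smooth_derive gs dir_u; have gv := smooth_derive gs dir_v.
    by apply: (smoothB Sigma_open); apply: (smoothM Sigma_open).
  have c2 : smooth Sigma (fun=> 2 : R) by exact: smooth_cst.
  apply: (smoothM Sigma_open).
    apply: (smoothB Sigma_open); apply: (smoothM Sigma_open) => //.
      apply: (smoothD Sigma_open); last exact: W.
      apply: (smoothD Sigma_open); last exact: W.
      by apply: (smoothM Sigma_open) => //; exact: W.
    apply: (smoothB Sigma_open); last exact: W.
    apply: (smoothD Sigma_open); last exact: W.
    by apply: (smoothM Sigma_open) => //; exact: W.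
  apply: (smoothV Sigma_open) => [p Sp|].
    by rewrite !mulf_neq0 ?pnatr_eq0 ?jacobian_ne0 // gt_eqF // N_gt0.
  apply: (smoothM Sigma_open) => //; apply: (smoothM Sigma_open); last exact: W.
  by apply: (smoothD Sigma_open); apply: (smoothM Sigma_open).
move=> p Sp; apply: (potentialE _ Sp).2.
have [e1 e2 e3] := (spin_closedE' Sp).1 (C p Sp).
have [q1 q2] := potential_alg (N_gt0 Sp) (jacobian_ne0 Sp) e3.
by split; [exact: e1|exact: e2|exact: q1|exact: q2].
Qed.

Section Transformed.
Variables (x' : plane R -> 'cV[R]_4) (rho : plane R -> R).
Hypothesis x'T : spin_transformation Sigma B x x'.
Hypothesis rhoP : spin_potential Sigma B x rho.

Let x's : smooth Sigma x'. Proof. by case: x'T. Qed.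
Let x'I p : Sigma p -> isotropic3 (x' p). Proof. by case: x'T => _ + _; apply. Qed.
Let x'D : spin_partials x'. Proof. by have /spin_transformationE[] := x'T. Qed.

Let sigma' q := sigma q + ln (N q).

Let expR_sigma' p : Sigma p -> expR (2 * sigma' p) = N p * N p * expR (2 * sigma p).
Proof.
move=> Sp; rewrite /sigma' mulrDr expRD mulrC; congr (_ * _).
by rewrite mulr2n mulrDl mul1r expRD lnK // posrE; exact: N_gt0.
Qed.

(** The conformal factor is multiplied by |a|^4 = e^(4 ln |a|), as
    dzeta' = a^2 dzeta. *)
Lemma conformal_at_transformed p : Sigma p -> conformal_at x' p (sigma' p).
Proof.
move=> Sp; apply/(conformal_atE Sigma_open x's x'I _ Sp).
have [_ u1 u2] := x'D dir_u Sp; have [_ v1 v2] := x'D dir_v Sp.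
have [eu ev euv] := metric Sp; rewrite (expR_sigma' Sp).
have E (s1 s2 t1 t2 s1' s2' t1' t2' r : R) : s1 = s1' -> s2 = s2' -> t1 = t1' -> t2 = t2' ->
  s1' * t1' + s2' * t2' = r -> s1 * t1 + s2 * t2 = r by move=> -> -> -> ->.
have scale (s t : R) : s = t -> N p * N p * s = N p * N p * t by move=> ->.
have norm := spin_norm (a1 p) (a2 p).
split.
- exact: (E _ _ _ _ _ _ _ _ _ u1 u2 u1 u2
    (etrans (norm ('D_e_u x1 p) ('D_e_u x2 p) _ _) (scale _ _ eu))).
- exact: (E _ _ _ _ _ _ _ _ _ v1 v2 v1 v2
    (etrans (norm ('D_e_v x1 p) ('D_e_v x2 p) _ _) (scale _ _ ev))).
- exact: (E _ _ _ _ _ _ _ _ _ u1 u2 v1 v2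
    (etrans (norm ('D_e_u x1 p) ('D_e_u x2 p) _ _) (etrans (scale _ _ euv) (mulr0 _)))).
Qed.

Lemma conformal_immersion_transformed : conformal_immersion Sigma x'.
Proof.
split; [exact: x's|exact: x'I| |].
  move=> p Sp a b e.
  have [eu ev euv] := (conformal_atE Sigma_open x's x'I _ Sp).1 (conformal_at_transformed Sp).
  have e1 := combination_entry e 1; have e2 := combination_entry e 2.
  rewrite (derive_coord x's 1 dir_u Sp) (derive_coord x's 1 dir_v Sp) in e1.
  rewrite (derive_coord x's 2 dir_u Sp) (derive_coord x's 2 dir_v Sp) in e2.
  exact: orthogonal_free (expR_gt0 _) eu ev euv e1 e2.
exists sigma'; last exact: conformal_at_transformed.
apply: (smoothD Sigma_open) => //; apply: (smooth_ln Sigma_open) => //.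
by apply: (smoothD Sigma_open); apply: (smoothM Sigma_open).
Qed.

Lemma laplacian_transformed p : Sigma p -> laplacian (fun q => x' q 0 0) p =
  N p * laplacian x0 p + 2 * rho p * N p * expR (2 * sigma p).
Proof.
move=> Sp.
have D w (wP : coordinate_direction w) : 'D_w ('D_w (fun q => x' q 0 0)) p = 'D_w (S0 w) p.
  by apply: (derive_congr Sigma_open) Sp => q Sq; have [] := x'D wP Sq.
have Su := derive_spin0 a1s a2s b1s b2s x0s x1s x2s dir_u dir_u Sp.
have Sv := derive_spin0 a1s a2s b1s b2s x0s x1s x2s dir_v dir_v Sp.
have [eu ev euv] := metric Sp.
have [l1 l2] := conformal_harmonic Sigma_open xs xI xC Sp.
have [_ P] := rhoP; have [w1 w2 q1 q2] := (potentialE (rho p) Sp).1 (P p Sp).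
apply: etrans (congr2 (fun s t : R => s + t) (etrans (D _ dir_u) Su) (etrans (D _ dir_v) Sv)) _.
exact: spin_laplacian_alg (expR_gt0 _) eu ev euv l1 l2 w1 w2 q1 q2.
Qed.

Lemma mean_curvature_transformed p : Sigma p ->
  mean_curvature x' p = (mean_curvature x p + (rho p)%:C) / \det (B p).
Proof.
move=> Sp; rewrite (mean_curvatureE Sigma_open x's x'I conformal_at_transformed Sp).
rewrite (mean_curvatureE Sigma_open xs xI xC Sp) (laplacian_transformed Sp) (det_group Sp).
rewrite -rmorphD -fmorphV -rmorphM; congr (_%:C).
rewrite !mulNr !expRN (expR_sigma' Sp) -/x0.
exact: mean_curvature_scale (expR_gt0 _) (N_gt0 Sp).
Qed.

End Transformed.
End SpinTransformation.

Theorem theorem3p6 (R : realType) (Sigma : set (plane R))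
    (x : plane R -> 'cV[R]_4) (B : plane R -> 'M[R[i]]_2)
    (hS : simply_connected_domain Sigma)
    (hx : conformal_immersion Sigma x)
    (hB : smooth_mx Sigma B)
    (hBG : forall p, Sigma p -> groupG (B p)) :
  [/\ (exists x' : plane R -> 'cV[R]_4, spin_transformation Sigma B x x') <->
      closed_form Sigma (spin_form B x),
      (exists x' : plane R -> 'cV[R]_4, spin_transformation Sigma B x x') <->
      (exists rho : plane R -> R, spin_potential Sigma B x rho) &
      forall (rho : plane R -> R) (x' : plane R -> 'cV[R]_4),
        spin_potential Sigma B x rho -> spin_transformation Sigma B x x' ->
        conformal_immersion Sigma x' /\
        forall p, Sigma p ->
          mean_curvature x' p = (mean_curvature x p + (rho p)%:C) / \det (B p)].
Proof.
have [xs xI _ [sigma sigmas xC]] := hx.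
have T_closed := (closed_spin_transformation hS xs xI hB hBG).
split.
- split=> [[x' T]|]; last exact: T_closed.
  exact: (@spin_transformation_closed _ _ hS _ _ xs xI hB hBG _ T).
- split=> [[x' T]|[rho P]].
    apply: (closed_spin_potential hS xs xI xC hB hBG).
    exact: (@spin_transformation_closed _ _ hS _ _ xs xI hB hBG _ T).
  by apply: T_closed; exact: (@spin_potential_closed _ _ hS _ _ xs xI hB hBG _ P).
- move=> rho x' P T; split.
    exact (conformal_immersion_transformed hS xs xI sigmas xC hB hBG T).
  by move=> p Sp; exact (mean_curvature_transformed hS xs xI xC hB hBG T P Sp).
Qed.
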